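(* Let $\Omega=\bigcup_{i=1}^n(\alpha_i,\beta_i)$ with $-\infty<\alpha_1<\beta_1<\alpha_2<\beta_2<\dots<\alpha_n<\beta_n<\infty$, and $J_i=(\alpha_i,\beta_i)$. Let $A$ be a self-adjoint extension of the operator $\mathsf D|_{C_c^\infty(\Omega)}$, $f\mapsto\frac1{2\pi i}f'$, in $L^2(\Omega)$, and let $B$ be its unitary boundary matrix. Let $P$ be the spectral measure of $A$, so that $A=\int_{\mathbb R}t\,dP(t)$. Then the spectral measure $P$ is atomic, supported on the spectrum $$\sigma(A)=\left\{\lambda\in\mathbb C:\det\left(I-E(\lambda\vec\beta)^{-1}BE(\lambda\vec\alpha)\right)=0\right\}\subseteq\mathbb R,$$ which is a discrete unbounded set. For $\lambda\in\sigma(A)$, the eigenspace $P(\{\lambda\})L^2(\Omega)$ has dimension at most $n$, and it consists of the functions of the form $$f(x)=e^{2\pi i\lambda x}\sum_{i=1}^nc_i\chi_{J_i}(x),\quad\text{where }c=(c_i)_{i=1}^n\in\mathbb C^n\text{ and }BE(\lambda\vec\alpha)c=E(\lambda\vec\beta)c.$$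
   Context: $\vec\alpha=(\alpha_1,\dots,\alpha_n)$, $\vec\beta=(\beta_1,\dots,\beta_n)$. For $\vec z=(z_1,\dots,z_n)\in\mathbb C^n$, $E(\vec z)$ denotes the $n\times n$ diagonal matrix with diagonal entries $e^{2\pi iz_1},\dots,e^{2\pi iz_n}$. Let $\mathscr D_{\max}=\{f:\Omega\to\mathbb C: f$ is absolutely continuous on each $J_i$ and $f'\in L^2(\Omega)\}$; for $f\in\mathscr D_{\max}$ put $f(\alpha_i):=f(\alpha_i+)$, $f(\beta_i):=f(\beta_i-)$ (these limits exist), $f(\vec\alpha)=(f(\alpha_1),\dots,f(\alpha_n))$, $f(\vec\beta)=(f(\beta_1),\dots,f(\beta_n))$. The self-adjoint extensions $A$ of $\mathsf D|_{C_c^\infty(\Omega)}$ (domain $C_c^\infty(\Omega)$) are exactly the operators with domain $\mathscr D_B=\{f\in\mathscr D_{\max}:Bf(\vec\alpha)=f(\vec\beta)\}$ and $Af=\frac1{2\pi i}f'$, where $B$ is a unitary $n\times n$ matrix; $B$ is called the boundary matrix associated to $A$. *)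

(* Defs.v *)
From HB Require Import structures.
From mathcomp Require Import all_boot all_order all_algebra.
From mathcomp Require Import spectral sesquilinear generic_quotient.
From mathcomp Require Import complex.
From mathcomp Require Import all_classical all_reals all_analysis.
From mathcomp Require Import measurable_realfun.
From mathcomp Require Import ring lra.

Set Implicit Arguments.
Unset Strict Implicit.
Unset Printing Implicit Defensive.

Import Order.TTheory GRing.Theory Num.Theory Num.Def.
Import complex ComplexField.Normc.
Import numFieldNormedType.Exports.

Local Open Scope classical_set_scope.
Local Open Scope ring_scope.
Local Open Scope complex_scope.

Section ComplexArith.
Variable R : realType.
Implicit Types z w : R[i].

Lemma sqr_normcE z : normc z ^+ 2 = Re z ^+ 2 + Im z ^+ 2.
Proof. by case: z => a b /=; rewrite sqr_sqrtr// addr_ge0 ?sqr_ge0. Qed.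

Lemma ReD z w : Re (z + w) = Re z + Re w. Proof. by case: z; case: w. Qed.
Lemma ImD z w : Im (z + w) = Im z + Im w. Proof. by case: z; case: w. Qed.
Lemma ReM z w : Re (z * w) = Re z * Re w - Im z * Im w.
Proof. by case: z; case: w. Qed.
Lemma ImM z w : Im (z * w) = Re z * Im w + Im z * Re w.
Proof. by case: z; case: w. Qed.
Lemma ReJ z : Re (conjc z) = Re z. Proof. by case: z. Qed.
Lemma ImJ z : Im (conjc z) = - Im z. Proof. by case: z. Qed.

Lemma complex_ext z w : Re z = Re w -> Im z = Im w -> z = w.
Proof. by case: z => a b; case: w => c d /= -> ->. Qed.

End ComplexArith.

(* The complex Hilbert space L^2(mu), as a quotient of the square-integrable *)
(* functions T -> R[i] by equality mu-almost everywhere.                     *)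
Section L2.
Context d (T : measurableType d) (R : realType).
Variable mu : {measure set T -> \bar R}.
Implicit Types f g h : T -> R[i].

Definition cmeasurable f : Prop :=
  measurable_fun [set: T] (fun x => Re (f x)) /\
  measurable_fun [set: T] (fun x => Im (f x)).

Definition square_integrable f : Prop :=
  cmeasurable f /\ (\int[mu]_x (normc (f x) ^+ 2)%:E < +oo)%E.

Definition L2pred : {pred T -> R[i]} := mem [set f | square_integrable f].

Lemma cmeasurable_lin (a : R[i]) f g :
  cmeasurable f -> cmeasurable g -> cmeasurable (a *: f + g).
Proof.
move=> [rf jf] [rg jg]; split.
- under eq_fun do rewrite ReD ReM.
  apply: measurable_funD => //; apply: measurable_funB;
    exact: measurable_funM.
- under eq_fun do rewrite ImD ImM.
  apply: measurable_funD => //; apply: measurable_funD;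
    exact: measurable_funM.
Qed.

Lemma measurable_sqr_normc f : cmeasurable f ->
  measurable_fun [set: T] (fun x => normc (f x) ^+ 2).
Proof.
move=> [rf jf]; under eq_fun do rewrite sqr_normcE.
by apply: measurable_funD; apply: measurable_funX.
Qed.

Lemma integrable_sqr_normc f : square_integrable f ->
  mu.-integrable [set: T] (EFin \o (fun x => normc (f x) ^+ 2)).
Proof.
move=> [mf foo]; apply/integrableP; split.
  exact/measurable_EFinP/measurable_sqr_normc.
by under eq_integral do rewrite /= ger0_norm ?sqr_ge0//.
Qed.

Lemma square_integrable_lin (a : R[i]) f g :
  square_integrable f -> square_integrable g ->
  square_integrable (a *: f + g).
Proof.
move=> sf sg; have [mf _] := sf; have [mg _] := sg.
have mafg := cmeasurable_lin a mf mg; split=> //.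
have iF := integrableZl measurableT (2 * normc a ^+ 2) (integrable_sqr_normc sf).
have iG := integrableZl measurableT 2 (integrable_sqr_normc sg).
have := integrableD measurableT iF iG.
have mE : measurable_fun [set: T]
    (fun x => (normc ((a *: f + g) x) ^+ 2)%:E).
  exact/measurable_EFinP/measurable_sqr_normc.
move=> /integrableP[mh]; apply: le_lt_trans; apply: ge0_le_integral => //.
- by move=> x _; rewrite lee_fin sqr_ge0.
- exact: measurableT_comp.
move=> x _ /=; rewrite lee_fin.
apply: le_trans (ler_norm _).
rewrite !sqr_normcE ReD ImD ReM ImM.
set p := Re a; set q := Im a; set r := Re (f x); set s := Im (f x).
set t := Re (g x); set u := Im (g x).
have := sqr_ge0 (p * r - q * s - t); have := sqr_ge0 (p * s + q * r - u).
nra.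
Qed.

Lemma square_integrable0 : square_integrable 0.
Proof.
split; first by split; exact: measurable_cst.
rewrite (eq_integral (cst 0%E)) ?integral0// => x _ /=.
by rewrite expr0n addr0 sqrtr0 expr0n.
Qed.

Lemma L2pred_submod_closed : submod_closed L2pred.
Proof.
split; first by apply/mem_set; exact: square_integrable0.
move=> a f g /set_mem sf /set_mem sg; apply/mem_set.
exact: square_integrable_lin.
Qed.

HB.instance Definition _ :=
  GRing.isSubmodClosed.Build R[i] (T -> R[i]) L2pred L2pred_submod_closed.

Record L2fun := MkL2fun { l2fun :> T -> R[i]; _ : l2fun \in L2pred }.
HB.instance Definition _ := [isSub for l2fun].
HB.instance Definition _ := [Choice of L2fun by <:].
HB.instance Definition _ := [SubChoice_isSubLmodule of L2fun by <:].

Lemma L2funP (f : L2fun) : square_integrable f.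
Proof. by have /set_mem := valP f. Qed.

Definition L2eq (f g : L2fun) := `[< (f : T -> R[i]) = g %[ae mu] >].

Lemma L2eq_is_equiv : equiv_class_of L2eq.
Proof.
split=> [f|f g|g f h].
- by apply/asboolP; exact: ae_eq_refl.
- by apply/asboolP/asboolP => ?; exact: ae_eq_sym.
- by move=> /asboolP fg /asboolP gh; apply/asboolP; exact: ae_eq_trans gh.
Qed.

Canonical L2eq_equiv := EquivRelPack L2eq_is_equiv.
Canonical L2eq_encModRel := defaultEncModRel L2eq.

Local Open Scope quotient_scope.

Definition L2 := {eq_quot L2eq}.
HB.instance Definition _ : EqQuotient L2fun L2eq L2 := EqQuotient.on L2.
HB.instance Definition _ := Choice.on L2.

Implicit Types u v w : L2.

Definition L2_fun (u : L2) : T -> R[i] := repr u.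
Coercion L2_fun : L2 >-> Funclass.

(* f is a representative of the class u *)
Definition represents u f : Prop := (u : T -> R[i]) = f %[ae mu].

Definition L2zero : L2 := lift_cst L2 0.
Definition L2add := lift_op2 L2 +%R.
Definition L2opp := lift_op1 L2 -%R.
Definition L2scale (a : R[i]) := lift_op1 L2 ( *:%R a).

Canonical pi_L2zero_morph := PiConst L2zero.

Lemma L2_reprE (f : L2fun) : (repr (\pi_L2 f) : T -> R[i]) = f %[ae mu].
Proof.
have : (repr (\pi_L2 f) == f %[mod L2])%qT by rewrite reprK.
by rewrite eqmodE => /asboolP.
Qed.

Lemma pi_L2opp : {morph \pi_L2 : f / - f >-> L2opp f}.
Proof.
move=> f; unlock L2opp; apply/eqP; rewrite eqmodE; apply/asboolP.
by apply: filterS (L2_reprE f) => x /(_ I) fx _; rewrite -[LHS]/(- f x) -fx.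
Qed.
Canonical pi_L2opp_morph := PiMorph1 pi_L2opp.

Lemma pi_L2add : {morph \pi_L2 : f g / f + g >-> L2add f g}.
Proof.
move=> f g; unlock L2add; apply/eqP; rewrite eqmodE; apply/asboolP.
apply: filterS2 (L2_reprE f) (L2_reprE g) => x /(_ I) fx /(_ I) gx _.
by rewrite -[LHS]/(f x + g x) -fx -gx.
Qed.
Canonical pi_L2add_morph := PiMorph2 pi_L2add.

Lemma pi_L2scale a : {morph \pi_L2 : f / a *: f >-> L2scale a f}.
Proof.
move=> f; unlock L2scale; apply/eqP; rewrite eqmodE; apply/asboolP.
by apply: filterS (L2_reprE f) => x /(_ I) fx _; rewrite -[LHS]/(a *: f x) -fx.
Qed.
Canonical pi_L2scale_morph a := PiMorph1 (pi_L2scale a).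

Lemma L2addA : associative L2add.
Proof. by move=> u v w; rewrite -[u]reprK -[v]reprK -[w]reprK !piE addrA. Qed.

Lemma L2addC : commutative L2add.
Proof. by move=> u v; rewrite -[u]reprK -[v]reprK !piE addrC. Qed.

Lemma L2add0 : left_id L2zero L2add.
Proof. by move=> u; rewrite -[u]reprK !piE add0r. Qed.

Lemma L2addN : left_inverse L2zero L2opp L2add.
Proof. by move=> u; rewrite -[u]reprK !piE addNr. Qed.

HB.instance Definition _ := GRing.isZmodule.Build L2 L2addA L2addC L2add0 L2addN.

Lemma L2scaleA a b u : L2scale a (L2scale b u) = L2scale (a * b) u.
Proof. by rewrite -[u]reprK !piE scalerA. Qed.

Lemma L2scale1 : left_id 1 L2scale.
Proof. by move=> u; rewrite -[u]reprK !piE scale1r. Qed.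

Lemma L2scaleDr : right_distributive L2scale +%R.
Proof.
move=> a u v; rewrite -[u]reprK -[v]reprK -[_ + _]/(L2add _ _).
by rewrite -[RHS]/(L2add _ _) !piE scalerDr.
Qed.

Lemma L2scaleDl u : {morph L2scale^~ u : a b / a + b}.
Proof.
by move=> a b; rewrite -[u]reprK -[RHS]/(L2add _ _) !piE scalerDl.
Qed.

HB.instance Definition _ := GRing.Zmodule_isLmodule.Build R[i] L2
  L2scaleA L2scale1 L2scaleDr L2scaleDl.

Lemma L2_linE a (u v : L2) :
  (a *: u + v : L2) = (a *: (u : T -> R[i]) + v) %[ae mu].
Proof.
have -> : a *: u + v = \pi_L2 (a *: repr u + repr v).
  by rewrite -[LHS]/(L2add (L2scale a u) v) -{1}[u]reprK -{1}[v]reprK !piE.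
exact: L2_reprE.
Qed.

Lemma L2_eqP (u v : L2) : (u : T -> R[i]) = v %[ae mu] -> u = v.
Proof.
move=> uv; rewrite -[u]reprK -[v]reprK; apply/eqP; rewrite eqmodE.
exact/asboolP.
Qed.

Lemma L2_sqint (u : L2) : square_integrable u. Proof. exact: L2funP. Qed.

Lemma L2_0E : ((0 : L2) : T -> R[i]) = 0 %[ae mu].
Proof.
have -> : (0 : L2) = \pi_L2 0 by rewrite -[LHS]/L2zero !piE.
exact: L2_reprE.
Qed.

Lemma integrable_mulJ f g : square_integrable f -> square_integrable g ->
  mu.-integrable [set: T] (EFin \o (fun x => Re (f x * conjc (g x)))) /\
  mu.-integrable [set: T] (EFin \o (fun x => Im (f x * conjc (g x)))).
Proof.
move=> sf sg; have [[rf jf] _] := sf; have [[rg jg] _] := sg.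
have ifg := integrableD measurableT (integrable_sqr_normc sf)
  (integrable_sqr_normc sg).
split; apply: le_integrable ifg => //.
- apply/measurable_EFinP; under eq_fun do rewrite ReM ReJ ImJ mulrN opprK.
  by apply: measurable_funD => //; apply: measurable_funM.
- move=> x _ /=; rewrite lee_fin ReM ReJ ImJ mulrN opprK.
  rewrite [leRHS]ger0_norm ?addr_ge0 ?sqr_ge0// !sqr_normcE.
  set r := Re (f x); set s := Im (f x); set t := Re (g x); set u := Im (g x).
  rewrite ler_norml; have := sqr_ge0 (r - t); have := sqr_ge0 (r + t).
  have := sqr_ge0 (s - u); have := sqr_ge0 (s + u).
  by move=> *; apply/andP; split; nra.
- apply/measurable_EFinP; under eq_fun do rewrite ImM ReJ ImJ mulrN addrC.
  by apply: measurable_funB => //; apply: measurable_funM.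
- move=> x _ /=; rewrite lee_fin ImM ReJ ImJ mulrN.
  rewrite [leRHS]ger0_norm ?addr_ge0 ?sqr_ge0// !sqr_normcE.
  set r := Re (f x); set s := Im (f x); set t := Re (g x); set u := Im (g x).
  rewrite ler_norml; have := sqr_ge0 (r - u); have := sqr_ge0 (r + u).
  have := sqr_ge0 (s - t); have := sqr_ge0 (s + t).
  by move=> *; apply/andP; split; nra.
Qed.

Definition l2dot (u v : L2) : R[i] :=
  (\int[mu]_x Re (u x * conjc (v x))) +i*
  (\int[mu]_x Im (u x * conjc (v x))).

Lemma l2dotPl a u v w : l2dot (a *: u + v) w = a * l2dot u w + l2dot v w.
Proof.
have [ruw juw] := integrable_mulJ (L2_sqint u) (L2_sqint w).
have [rvw jvw] := integrable_mulJ (L2_sqint v) (L2_sqint w).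
have [rw jw] := integrable_mulJ (L2_sqint (a *: u + v)) (L2_sqint w).
have int_lin (p q : R) (F G H : T -> R) :
    mu.-integrable [set: T] (EFin \o F) ->
    mu.-integrable [set: T] (EFin \o G) ->
    mu.-integrable [set: T] (EFin \o H) ->
    \int[mu]_x (p * F x + q * G x + H x) =
    p * (\int[mu]_x F x) + q * (\int[mu]_x G x) + \int[mu]_x H x.
  move=> iF iG iH.
  have ipF : mu.-integrable [set: T] (EFin \o (fun x => p * F x)).
    exact: (integrableZl measurableT p iF).
  have iqG : mu.-integrable [set: T] (EFin \o (fun x => q * G x)).
    exact: (integrableZl measurableT q iG).
  have iS : mu.-integrable [set: T] (EFin \o (fun x => p * F x + q * G x)).
    exact: (integrableD measurableT ipF iqG).
  by rewrite RintegralD// RintegralD// !RintegralZl.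
apply: complex_ext; rewrite [LHS]/= ?(ReD, ImD, ReM, ImM) /=.
- rewrite -mulNr -int_lin//; congr fine; apply: ae_eq_integral => //.
  + exact: measurable_int rw.
  + have i1 := integrableZl measurableT (Re a) ruw.
    have i2 := integrableZl measurableT (- Im a) juw.
    exact: measurable_int
      (integrableD measurableT (integrableD measurableT i1 i2) rvw).
  + apply: filterS (L2_linE a u v) => x /(_ I) -> _; congr EFin.
    by rewrite -[in LHS]/(a * u x + v x) !(ReD, ImD, ReM, ImM, ReJ, ImJ); ring.
- rewrite -int_lin//; congr fine; apply: ae_eq_integral => //.
  + exact: measurable_int jw.
  + have i1 := integrableZl measurableT (Re a) juw.
    have i2 := integrableZl measurableT (Im a) ruw.
    exact: measurable_int
      (integrableD measurableT (integrableD measurableT i1 i2) jvw).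
  + apply: filterS (L2_linE a u v) => x /(_ I) -> _; congr EFin.
    by rewrite -[in LHS]/(a * u x + v x) !(ReD, ImD, ReM, ImM, ReJ, ImJ); ring.
Qed.

Lemma l2dotC u v : l2dot u v = conjc (l2dot v u).
Proof.
have [_ jvu] := integrable_mulJ (L2_sqint v) (L2_sqint u).
apply: complex_ext; rewrite ?ReJ ?ImJ /=.
- by apply: eq_Rintegral => x _; rewrite !ReM !ReJ !ImJ; ring.
- rewrite -mulN1r -RintegralZl//; apply: eq_Rintegral => x _.
  by rewrite !ImM !ReJ !ImJ; ring.
Qed.

Lemma l2dot_gt0 u : u != 0 -> 0 < l2dot u u.
Proof.
move=> u0; rewrite ltcE /=; apply/andP; split.
  apply/eqP; rewrite (@eq_Rintegral _ _ _ mu setT (cst 0)) => [|x _].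
    by rewrite /Rintegral integral0.
  by rewrite ImM ReJ ImJ /=; ring.
rewrite (@eq_Rintegral _ _ _ mu setT (fun x => normc (u x) ^+ 2)) => [|x _];
  last by rewrite ReM ReJ ImJ sqr_normcE; ring.
have iu := integrable_sqr_normc (L2_sqint u).
rewrite lt0r Rintegral_ge0 ?andbT => [|x _]; last exact: sqr_ge0.
apply: contra u0 => /eqP Iu0; apply/eqP/L2_eqP.
have : (\int[mu]_x `|(normc (u x) ^+ 2)%:E| = 0)%E.
  have /integrableP[mE iE] := iu.
  have -> : (\int[mu]_x `|(normc (u x) ^+ 2)%:E| =
             \int[mu]_x (normc (u x) ^+ 2)%:E)%E.
    by apply: eq_integral => x _; rewrite gee0_abs// lee_fin sqr_ge0.
  by rewrite -[LHS]fineK ?(integrable_fin_num measurableT iu)// -/(Rintegral _ _ _) Iu0.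
move/(ae_eq_integral_abs _ measurableT (measurable_int _ iu)) => h.
apply: filterS2 h L2_0E => x /(_ I) hx /(_ I) -> _.
move: hx => -[] /eqP; rewrite expf_eq0/= => /eqP.
exact: eq0_normc.
Qed.

Lemma l2dot_zmodl v : zmod_morphism (l2dot^~ v).
Proof.
by move=> x y; rewrite addrC -scaleN1r l2dotPl mulN1r addrC.
Qed.

Lemma l2dot_zmodr u : zmod_morphism (l2dot u).
Proof.
move=> x y; rewrite l2dotC (l2dotC u x) (l2dotC u y).
by rewrite l2dot_zmodl rmorphB.
Qed.

Lemma l2dot_scalel v : scalable_for *%R (l2dot^~ v).
Proof.
move=> a x; rewrite -[a *: x]addr0 l2dotPl.
by have := l2dot_zmodl v 0 0; rewrite !subrr => ->; rewrite addr0.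
Qed.

Lemma l2dot_scaler u : scalable_for (conjC \; *%R) (l2dot u).
Proof. by move=> a x; rewrite l2dotC (l2dotC u x) l2dot_scalel rmorphM. Qed.

HB.instance Definition _ := isBilinear.Build R[i] L2 L2 R[i] *%R
  (conjC \; *%R) l2dot l2dot_zmodl l2dot_zmodr l2dot_scalel l2dot_scaler.

Lemma l2dot_herm u v : l2dot u v = (-1) ^+ false * conjC (l2dot v u).
Proof. by rewrite expr0 mul1r; exact: l2dotC. Qed.

HB.instance Definition _ :=
  isHermitianSesquilinear.Build R[i] L2 false conjC l2dot l2dot_herm.

HB.instance Definition _ := isDotProduct.Build R[i] L2 l2dot l2dot_gt0.

End L2.

(* Unbounded operators in a complex inner product space, identified with     *)
(* their graphs.                                                             *)
Section Operators.
(* dot is linear in its first argument, conjugate-linear in its second one *)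
Variables (R : realType) (H : lmodType R[i]) (dot : {dot H for conjC}).
Implicit Types (A : set (H * H)) (u v w : H).

Local Notation "''[' u , v ]" := (dot u v) : ring_scope.

Definition hnorm u : R := Num.sqrt (Re '[u, u]).

Definition domain A : set H := [set u | exists v, A (u, v)].

Definition is_operator A : Prop :=
  [/\ A (0, 0),
      forall (a : R[i]) p q, A p -> A q -> A (a *: p + q) &
      forall u v w, A (u, v) -> A (u, w) -> v = w].

Definition densely_defined A : Prop :=
  forall u (e : R), 0 < e -> exists2 v, domain A v & hnorm (u - v) < e.

Definition adjoint A : set (H * H) :=
  [set p | forall q, A q -> '[q.2, p.1] = '[q.1, p.2]].

Definition self_adjoint A : Prop :=
  [/\ is_operator A, densely_defined A & A = adjoint A].

Definition bounded_operator (S : H -> H) : Prop :=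
  exists M : R, forall u, hnorm (S u) <= M * hnorm u.

(* A - l is a bijection from its domain onto H, with bounded inverse S *)
Definition resolvent_set A : set R[i] :=
  [set l | exists S : {linear H -> H}, bounded_operator S /\
     forall u v, A (u, v + l *: u) <-> u = S v].

Definition spectrum A : set R[i] := ~` resolvent_set A.

(* V is a linear subspace with a basis of cardinality k *)
Definition has_dimension (V : set H) (k : nat) : Prop :=
  exists b : 'I_k -> H,
    (forall c : 'I_k -> R[i], \sum_i c i *: b i = 0 -> forall i, c i = 0) /\
    V = [set \sum_i c i *: b i | c in [set: 'I_k -> R[i]]].

(* Projection-valued measures on the Borel sets of R: orthogonal projections *)
(* P(E) with P(set0) = 0, P(R) = 1 and E |-> <P(E)u, u> = |P(E)u|^2 countably *)
(* additive for all u. The values P(E) for E not Borel are junk.             *)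
Record pvm := Pvm {
  pvm_proj :> set R -> {linear H -> H} ;
  pvm_idem : forall E u, measurable E ->
    pvm_proj E (pvm_proj E u) = pvm_proj E u ;
  pvm_sym : forall E u v, measurable E ->
    '[pvm_proj E u, v] = '[u, pvm_proj E v] ;
  pvm0 : forall u, pvm_proj set0 u = 0 ;
  pvmT : forall u, pvm_proj [set: R] u = u ;
  pvm_sigma_additive : forall u,
    semi_sigma_additive (fun E : set R => (hnorm (pvm_proj E u) ^+ 2)%:E)
}.

(* the measure d<P(t)u, u> *)
Definition spectral_dist (P : pvm) u (E : set R) : \bar R :=
  (hnorm (P E u) ^+ 2)%:E.

Section SpectralDist.
Variables (P : pvm) (u : H).

Let spectral_dist0 : spectral_dist P u set0 = 0%E.
Proof.
by rewrite /spectral_dist /hnorm pvm0 linear0r sqrtr0 expr0n.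
Qed.

Let spectral_dist_ge0 E : (0 <= spectral_dist P u E)%E.
Proof. by rewrite lee_fin sqr_ge0. Qed.

HB.instance Definition _ := isMeasure.Build _ _ _ (spectral_dist P u)
  spectral_dist0 spectral_dist_ge0 (@pvm_sigma_additive P u).

End SpectralDist.

(* A = \int t dP(t): the domain of A consists of the u such that             *)
(* \int t^2 d<P(t)u, u> is finite, and <Au, u> = \int t d<P(t)u, u> there;   *)
(* by polarization, this determines A when its domain is dense.              *)
Definition spectral_measure A (P : pvm) : Prop :=
  domain A =
    [set u | (\int[spectral_dist P u]_t (t ^+ 2)%:E < +oo)%E] /\
  forall u v, A (u, v) -> '[v, u] = (\int[spectral_dist P u]_t t)%:C.

Definition pvm_null (P : pvm) (E : set R) : Prop := forall u, P E u = 0.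

Definition pvm_atom (P : pvm) (E : set R) : Prop :=
  [/\ measurable E, ~ pvm_null P E &
      forall F, measurable F -> F `<=` E ->
        pvm_null P F \/ pvm_null P (E `\` F)].

Definition atomic (P : pvm) : Prop :=
  forall E, measurable E -> ~ pvm_null P E ->
    exists2 F, F `<=` E & pvm_atom P F.

End Operators.

Section Boundary.
Variables (R : realType) (n : nat) (alpha beta : 'I_n -> R).
Implicit Types f g : R -> R[i].

Definition J (i : 'I_n) : set R := `]alpha i, beta i[%classic.

Definition Omega : set R := \bigcup_i J i.

Lemma measurable_Omega : measurable Omega.
Proof.
apply: fin_bigcup_measurable => [|i _]; last exact: measurable_itv.
exact: finite_finset.
Qed.

Definition lebesgue_Omega : {measure set (measurableTypeR R) -> \bar R} :=
  mrestr (@lebesgue_measure R) measurable_Omega.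

Local Notation L2_Omega := (L2 lebesgue_Omega).

Definition dot_Omega : {dot L2_Omega for conjC} := @l2dot _ _ _ lebesgue_Omega.

Definition cderive f (x : R) : R[i] :=
  derive1 (fun t => Re (f t)) x +i* derive1 (fun t => Im (f t)) x.

Definition two_pi_i : R[i] := 0 +i* (2 * pi).

Definition smooth (h : R -> R) : Prop :=
  forall k x, derivable (derive1n k h) x 1.

Definition Cc_infty_Omega f : Prop :=
  [/\ smooth (fun x => Re (f x)), smooth (fun x => Im (f x)) &
      exists K : set R,
        [/\ compact K, K `<=` Omega & forall x, ~ K x -> f x = 0]].

(* the operator f |-> f' / (2 pi i) with domain C_c^oo(Omega) *)
Definition D_test : set (L2_Omega * L2_Omega) :=
  [set p : L2_Omega * L2_Omega | exists2 f, Cc_infty_Omega f &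
     represents p.1 f /\
     represents p.2 (fun x => two_pi_i^-1 * cderive f x)].

Definition absolutely_continuous f (a b : R) : Prop :=
  forall e : R, 0 < e -> exists2 delta : R, 0 < delta &
    forall (m : nat) (x y : nat -> R),
      (forall k, (k < m)%N -> a < x k /\ x k <= y k /\ y k < b) ->
      trivIset `I_m (fun k => `]x k, y k[%classic) ->
      \sum_(k < m) (y k - x k) < delta ->
      \sum_(k < m) normc (f (y k) - f (x k)) < e.

(* Absolute continuity makes f differentiable almost everywhere, so the total *)
(* derivative cderive f is the genuine f' up to a null set. The values of f  *)
(* outside of Omega play no role.                                            *)
Definition D_max f : Prop :=
  (forall i, absolutely_continuous f (alpha i) (beta i)) /\
  exists v : L2_Omega, represents v (cderive f).

Definition at_alpha f : 'cV[R[i]]_n :=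
  \col_i (lim (Re (f x) @[x --> (alpha i)^'+]) +i*
          lim (Im (f x) @[x --> (alpha i)^'+])).

Definition at_beta f : 'cV[R[i]]_n :=
  \col_i (lim (Re (f x) @[x --> (beta i)^'-]) +i*
          lim (Im (f x) @[x --> (beta i)^'-])).

Definition D_boundary (B : 'M[R[i]]_n) : set (L2_Omega * L2_Omega) :=
  [set p : L2_Omega * L2_Omega | exists f, [/\ D_max f, B *m at_alpha f = at_beta f,
     represents p.1 f &
     represents p.2 (fun x => two_pi_i^-1 * cderive f x)]].

Definition boundary_matrix (A : set (L2_Omega * L2_Omega)) (B : 'M[R[i]]_n) :=
  B \is unitarymx /\ A = D_boundary B.

Definition cexp (z : R[i]) : R[i] :=
  (expR (Re z))%:C * (cos (Im z) +i* sin (Im z)).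

(* E(z) *)
Definition Emx (z : 'I_n -> R[i]) : 'M[R[i]]_n :=
  diag_mx (\row_i cexp (two_pi_i * z i)).

Definition eigenfunction (l : R[i]) (c : 'cV[R[i]]_n) (x : R) : R[i] :=
  cexp (two_pi_i * (l * x%:C)) * \sum_i c i 0 * (\1_(J i) x)%:C.

End Boundary.

Arguments D_test {R n} alpha beta _.
Notation L2_Omega alpha beta := (L2 (lebesgue_Omega alpha beta)).

(* Main.v *)
(** On each J_i, the equation (A - l) w = u is solved by variation of constants,
      w(x) = e^{2 pi i l x} (c_i + 2 pi i int_{alpha_i}^x e^{-2 pi i l y} u(y) dy),
    so the boundary condition is a linear system for c with the matrix
    I - E(l beta)^{-1} B E(l alpha). When that matrix is invertible, A - l is
    onto with a bounded right inverse; when it is singular, l is an eigenvalue,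
    hence real because A is symmetric. Injectivity comes for free: as A = A*, the
    kernel of A - l is orthogonal to the range of A - conj l.

    For real l and u orthogonal to the n functions e^{2 pi i l x} 1_{J_i}, c = 0
    works for every B and gives |w| <= K |u| with K independent of l. If z is an
    eigenvector for l, then <z, u> = <z, (A - l) w> = 0, so z is a combination of
    these n functions; no uniqueness theorem for absolutely continuous functions
    is needed. On the range of P([a - d, a + d]) one has |(A - a) x| <= d |x|, so
    for d K < 1 the same pairing shows that a vector of this range orthogonal to
    the n functions vanishes. Hence that range has dimension at most n, and the
    spectrum is locally finite.

    P commutes with A, P({l}) projects onto ker (A - l), and P vanishes near the
    points of the resolvent set; this makes P atomic. If the spectrum were
    bounded, A would be everywhere defined, but a step function is not equal
    almost everywhere to an absolutely continuous one. *)

Require Import Defs.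
From HB Require Import structures.
From mathcomp Require Import all_boot all_order all_algebra.
From mathcomp Require Import spectral sesquilinear complex.
From mathcomp Require Import all_classical all_reals all_analysis.
From mathcomp Require Import measurable_realfun ring lra.

Import Order.TTheory GRing.Theory Num.Theory Num.Def.
Import complex ComplexField.Normc.
Import numFieldNormedType.Exports.

Import Defs.
Local Open Scope classical_set_scope.
Local Open Scope ring_scope.
Local Open Scope complex_scope.

Lemma Re_opp (R : realType) (z : R[i]) : Re (- z) = - Re z.
Proof. by case: z. Qed.

Lemma Im_opp (R : realType) (z : R[i]) : Im (- z) = - Im z.
Proof. by case: z. Qed.

(** * Real inner products, Cauchy-Schwarz and polarization in a Hermitian space *)

Section HermitianSpace.
Set Implicit Arguments.
Unset Strict Implicit.
Variables (R : realType) (H : lmodType R[i]) (dot : {dot H for conjC}).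
Implicit Types (u v w x y : H).
Local Notation "''[' u , v ]" := (dot u v) : ring_scope.

(** The underlying real inner product. Its values lie in the ordered field [R], so quadratic
    estimates become goals for [lra] and [nra]. *)
Definition rdot u v : R := Re '[u, v].

Lemma dotC u v : '[u, v] = conjc '[v, u].
Proof. by rewrite hermC expr0 mul1r. Qed.

Lemma rdotC u v : rdot u v = rdot v u.
Proof. by rewrite /rdot dotC ReJ. Qed.

(* The library's [linearDl] and friends leave the form under the weaker
   bilinear structure, where later rewrites no longer recognize it. *)
Lemma dotDl u v w : '[u + v, w] = '[u, w] + '[v, w].
Proof. exact: linearDl. Qed.

Lemma dotDr u v w : '[w, u + v] = '[w, u] + '[w, v].
Proof. exact: linearDr. Qed.

Lemma dotZl a u v : '[a *: u, v] = a * '[u, v].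
Proof. exact: linearZl_LR. Qed.

Lemma dotZr a u v : '[u, a *: v] = conjc a * '[u, v].
Proof. exact: linearZr_LR. Qed.

Lemma dotNl u v : '[- u, v] = - '[u, v].
Proof. exact: linearNl. Qed.

Lemma rdotDl u v w : rdot (u + v) w = rdot u w + rdot v w.
Proof. by rewrite /rdot linearDl ReD. Qed.

Lemma rdotDr u v w : rdot w (u + v) = rdot w u + rdot w v.
Proof. by rewrite !(rdotC w) rdotDl. Qed.

Lemma rdotNl u v : rdot (- u) v = - rdot u v.
Proof. by rewrite /rdot linearNl Re_opp. Qed.

Lemma rdotNr u v : rdot v (- u) = - rdot v u.
Proof. by rewrite !(rdotC v) rdotNl. Qed.

Lemma rdotZl (a : R) u v : rdot (a%:C *: u) v = a * rdot u v.
Proof. by rewrite /rdot linearZl_LR ReM /= mul0r subr0. Qed.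

Lemma rdotZr (a : R) u v : rdot v (a%:C *: u) = a * rdot v u.
Proof. by rewrite !(rdotC v) rdotZl. Qed.

(** As Re (i z) = - Im z, the second hypothesis kills the imaginary part; complex orthogonality can
    thus be checked on real inner products. *)
Lemma dot_eq0 u v : rdot u v = 0 -> rdot ('i *: u) v = 0 -> '[u, v] = 0.
Proof.
rewrite /rdot linearZl_LR ReM /= mul0r sub0r mul1r => h1 h2.
by apply: complex_ext => //=; rewrite -[LHS]opprK h2 oppr0.
Qed.

Lemma Im_dotuu u : Im '[u, u] = 0.
Proof. by have := dotC u u; case: ('[u, u]) => a b [] /=; lra. Qed.

Lemma rdot_ge0 u : 0 <= rdot u u.
Proof. by have := dnorm_ge0 dot u; rewrite lecE /= => /andP[]. Qed.

Lemma dotuuE u : '[u, u] = (rdot u u)%:C.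
Proof. by apply: complex_ext => //=; exact: Im_dotuu. Qed.

Lemma rdot_eq0 u : rdot u u = 0 -> u = 0.
Proof. by move=> h; apply/eqP; rewrite -(dnorm_eq0 dot) dotuuE h. Qed.

Lemma sqr_hnorm u : hnorm dot u ^+ 2 = rdot u u.
Proof. by rewrite sqr_sqrtr // rdot_ge0. Qed.

Lemma hnorm_ge0 u : 0 <= hnorm dot u. Proof. exact: sqrtr_ge0. Qed.

Lemma hnorm_eq0 u : hnorm dot u = 0 -> u = 0.
Proof. by move=> h; apply: rdot_eq0; rewrite -sqr_hnorm h expr0n. Qed.

(** Cauchy-Schwarz: with p = |u| and q = |v|, the squared norm of q u - p v is 2 p q (p q - Re <u,
    v>). *)
Lemma rdot_le u v : rdot u v <= hnorm dot u * hnorm dot v.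
Proof.
have [u0|u0] := eqVneq (hnorm dot u) 0.
  by rewrite u0 (hnorm_eq0 u0) mul0r /rdot linear0l.
have [v0|v0] := eqVneq (hnorm dot v) 0.
  by rewrite v0 (hnorm_eq0 v0) mulr0 /rdot linear0r.
have p0 : 0 < hnorm dot u by rewrite lt_def u0 hnorm_ge0.
have q0 : 0 < hnorm dot v by rewrite lt_def v0 hnorm_ge0.
set p := hnorm dot u in p0 *; set q := hnorm dot v in q0 *.
have := rdot_ge0 (q%:C *: u - p%:C *: v).
rewrite !(rdotDl, rdotDr, rdotNl, rdotNr, rdotZl, rdotZr) (rdotC v u).
rewrite -!sqr_hnorm -/p -/q => h.
have {h} : 0 <= (2 * p * q) * (p * q - rdot u v) by nra.
by rewrite pmulr_rge0 ?subr_ge0 // !mulr_gt0.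
Qed.

Lemma hnormZ (a : R) u : hnorm dot (a%:C *: u) = `|a| * hnorm dot u.
Proof.
rewrite /hnorm -/(rdot _ _) rdotZl rdotZr mulrA -expr2 sqrtrM ?sqr_ge0 //.
by rewrite sqrtr_sqr.
Qed.

(** Polarization at u + w and u + i w shows that the sum and the difference of <T u, w> and <T w, u>
    vanish; then take w = T u. Complex scalars are essential: a rotation of the real plane by a
    right angle has zero quadratic form. *)
Lemma quadratic_form0 (T : {linear H -> H}) :
  (forall u, '[T u, u] = 0) -> forall u, T u = 0.
Proof.
move=> T0 u; apply: (@rdot_eq0 _); rewrite /rdot.
suff -> : '[T u, T u] = 0 by [].
have pol x y : '[T x, y] + '[T y, x] = 0.
  have := T0 (x + y); rewrite (linearD T) dotDl !dotDr !T0.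
  by rewrite add0r addr0.
set w := T u; have h1 := pol u w; have := pol u ('i *: w).
rewrite dotZr (linearZ_LR T) dotZl.
have -> : conjc ('i : R[i]) = - 'i by apply: complex_ext => /=; rewrite ?oppr0.
rewrite mulNr -mulrN -mulrDr => /eqP; rewrite mulf_eq0.
have -> /= : ('i == 0 :> R[i]) = false.
  by apply/eqP => /(congr1 (@Im R)) /= /eqP; rewrite oner_eq0.
move=> /eqP h2; move: h1 h2; set A := '[T u, w]; set B := '[T w, u] => h1 h2.
have : A *+ 2 = (A + B) - (- A + B) by ring.
by rewrite h1 h2 subr0 => /eqP; rewrite mulrn_eq0 /= => /eqP.
Qed.

End HermitianSpace.

(** * Spectral projections *)

Section SpectralProjections.
Set Implicit Arguments.
Unset Strict Implicit.
Variables (R : realType) (H : lmodType R[i]) (dot : {dot H for conjC}).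
Variable P : pvm dot.
Implicit Types (u v w x y : H) (E F : set R).
Local Notation "''[' u , v ]" := (dot u v) : ring_scope.
Local Notation "''|' u |" := (hnorm dot u) (at level 0, format "''|' u |").

Lemma pvm_hnormU E F u : measurable E -> measurable F -> E `&` F = set0 ->
  '|P (E `|` F) u| ^+ 2 = '|P E u| ^+ 2 + '|P F u| ^+ 2.
Proof.
by move=> mE mF EF; have [] := measureU (spectral_dist P u) mE mF EF.
Qed.

Lemma pvm_dotuu E u : measurable E -> '[P E u, u] = ('|P E u| ^+ 2)%:C.
Proof.
move=> mE; rewrite -{1}pvm_idem // pvm_sym // dotuuE.
by rewrite -sqr_hnorm.
Qed.

(** A [pvm] is additive only at the level of the forms |P(E) u|^2; [quadratic_form0] lifts this to
    the operators. *)
Lemma pvmU E F u : measurable E -> measurable F -> E `&` F = set0 ->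
  P (E `|` F) u = P E u + P F u.
Proof.
move=> mE mF EF.
pose T : {linear H -> H} := P (E `|` F) \- (P E \+ P F).
have T0 x : '[T x, x] = 0.
  rewrite /T /= dotDl dotNl dotDl !pvm_dotuu //; last exact: measurableU.
  by rewrite pvm_hnormU // rmorphD subrr.
have /eqP := quadratic_form0 T0 u; rewrite /T /= subr_eq0 => /eqP.
by [].
Qed.

Lemma pvmC E u : measurable E -> u = P E u + P (~` E) u.
Proof.
move=> mE; rewrite -pvmU //; last by rewrite setICr.
  by rewrite setUCr pvmT.
exact: measurableC.
Qed.

(** For x = P(F) u, split |x|^2 over [E], [F] and the rest of the line: the [F] part is already all
    of |x|^2, so the other parts are 0. *)
Lemma pvm_disjoint E F u : measurable E -> measurable F -> E `&` F = set0 ->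
  P E (P F u) = 0.
Proof.
move=> mE mF EF; set x := P F u.
have mU : measurable (E `|` F) by exact: measurableU.
have := pvm_hnormU (P F u) mU (measurableC mU) (setICr _).
rewrite setUCr pvmT pvm_hnormU // pvm_idem // -/x => h.
apply: (@hnorm_eq0 _ _ dot); apply/eqP.
have := sqr_ge0 '|P (~` (E `|` F)) x|; have := sqr_ge0 '|P E x| => h1 h2.
by rewrite -[_ == _]sqrf_eq0; apply/eqP; lra.
Qed.

Lemma pvmI E F u : measurable E -> measurable F -> P E (P F u) = P (E `&` F) u.
Proof.
move=> mE mF; have mEF : measurable (E `&` F) by exact: measurableI.
have mFE' : measurable (F `&` E) by exact: measurableI.
have mFE : measurable (F `\` E) by exact: measurableD.
have mED : measurable (E `\` F) by exact: measurableD.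
rewrite -{1}(setUIDK F E) pvmU //; last by rewrite setDE setIACA setICr setI0.
rewrite linearD [X in _ + X]pvm_disjoint ?addr0 //; last first.
  by rewrite setDE setICA setICr setI0.
rewrite -{1}(setUIDK E F) pvmU //; last by rewrite setDE setIACA setICr setI0.
rewrite (setIC F E) pvm_idem // [X in _ + X]pvm_disjoint ?addr0 //.
by rewrite setDE setIACA [_ `&` F]setIC setICr setI0.
Qed.

Lemma spectral_dist_proj E F u : measurable E -> measurable F ->
  spectral_dist P (P E u) F = spectral_dist P u (F `&` E).
Proof. by move=> mE mF; rewrite /spectral_dist pvmI. Qed.

(** Since P(F) P(E) = P(F [&] E), the measure attached to P(E) u is the restriction to [E] of the
    one attached to u. *)
Lemma ge0_integral_proj E u (f : R -> \bar R) : measurable E ->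
  measurable_fun [set: R] f -> (forall t, 0 <= f t)%E ->
  (\int[spectral_dist P (P E u)]_t f t = \int[spectral_dist P u]_(t in E) f t)%E.
Proof.
move=> mE mf f0.
rewrite (@ge0_negligible_integral _ _ _ _ _ (~` E)) //; last 2 first.
- exact: measurableC.
- by rewrite -[LHS]/(spectral_dist P _ _) spectral_dist_proj // ?setICl
     ?measure0 //; exact: measurableC.
rewrite setTD setCK; apply: eq_measure_integral => F mF FE.
by rewrite -[LHS]/(spectral_dist P _ _) spectral_dist_proj // (setIidl FE).
Qed.

Lemma integral_proj E u (f : R -> \bar R) : measurable E ->
  measurable_fun [set: R] f ->
  (\int[spectral_dist P (P E u)]_t f t = \int[spectral_dist P u]_(t in E) f t)%E.
Proof.
move=> mE mf; rewrite integralE [RHS]integralE; congr (_ - _)%E.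
  by apply: ge0_integral_proj => //; exact: measurable_funepos.
by apply: ge0_integral_proj => //; exact: measurable_funeneg.
Qed.

Lemma spectral_dist_lty u E : (spectral_dist P u E < +oo)%E.
Proof. by rewrite ltry. Qed.

Lemma pvm_sub E F u : measurable E -> measurable F -> E `<=` F ->
  P F u = 0 -> P E u = 0.
Proof. by move=> mE mF EF F0; rewrite -(setIidl EF) -pvmI // F0 linear0. Qed.

(** A Lindelöf argument: countably many rational intervals of zero mass for u cover [E], and the
    spectral distribution is countably subadditive. *)
Lemma pvm_locally_null E u : measurable E ->
  (forall t, E t -> exists2 e : R, 0 < e & P `]t - e, t + e[%classic u = 0) ->
  P E u = 0.
Proof.
move=> mE loc.
(* [I] enumerates the intervals with rational endpoints, with the empty set for a number that codes
   no pair; [F] below keeps those without mass for u. *)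
pose I (i : nat) : set R := if unpickle i is Some (p, q)
  then `]ratr p, ratr q[%classic else set0.
have mI i : measurable (I i).
  by rewrite /I; case: unpickle => [[p q]|]; [exact: measurable_itv|].
pose F i := if `[< P (I i) u = 0 >] then I i else set0.
have F0 i : (spectral_dist P u).-negligible (F i).
  rewrite /F; case: asboolP => [h|_]; last exact: negligible_set0.
  by apply/negligibleP => //; rewrite /= /spectral_dist h /hnorm linear0l
    sqrtr0 expr0n.
have EF : E `<=` \bigcup_i F i.
  move=> t /loc[e e0 te].
  have [p pt] : exists p : rat, ratr p \in `]t - e, t[.
    by apply: rat_in_itvoo; rewrite ltrBlDr ltrDl.
  have [q qt] : exists q : rat, ratr q \in `]t, t + e[.
    by apply: rat_in_itvoo; rewrite ltrDl.
  have pqt : (`]ratr p, ratr q[ `<=` `]t - e, t + e[)%classic.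
    move: pt qt; rewrite !in_itv /= => /andP[p1 p2] /andP[q1 q2] x /=.
    by rewrite !in_itv /=; lra.
  exists (pickle (p, q)) => //; rewrite /F /I pickleK.
  case: asboolP => [_|[]]; last exact: (pvm_sub _ _ pqt).
  by move: pt qt; rewrite /= !in_itv /=; lra.
have : (spectral_dist P u).-negligible E.
  exact: negligibleS EF (negligible_bigcup F0).
move=> /negligibleP => /(_ mE) [] /eqP; rewrite sqrf_eq0 => /eqP.
exact: hnorm_eq0.
Qed.

End SpectralProjections.

(** * Self-adjoint operators and their spectral measures *)

Section SpectralTheory.
Set Implicit Arguments.
Unset Strict Implicit.
Variables (R : realType) (H : lmodType R[i]) (dot : {dot H for conjC}).
Variables (A : set (H * H)) (P : pvm dot).
Hypotheses (A_sa : self_adjoint dot A) (A_P : spectral_measure A P).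
Implicit Types (u v w x y : H) (E F : set R).
Local Notation "''[' u , v ]" := (dot u v) : ring_scope.
Local Notation "''|' u |" := (hnorm dot u) (at level 0, format "''|' u |").
Local Notation rdot := (rdot dot).
Local Notation dist := (spectral_dist P).

Lemma sa_lin (a : R[i]) u u' v v' :
  A (u, u') -> A (v, v') -> A (a *: u + v, a *: u' + v').
Proof. by have [[_ Alin _] _ _] := A_sa => Au Av; exact: (Alin a _ _ Au Av). Qed.

Lemma sa0 : A (0, 0). Proof. by have [[]] := A_sa. Qed.

Lemma sa_D u u' v v' : A (u, u') -> A (v, v') -> A (u + v, u' + v').
Proof. by move=> Au Av; have := sa_lin 1 Au Av; rewrite !scale1r. Qed.

Lemma sa_Z (a : R[i]) u u' : A (u, u') -> A (a *: u, a *: u').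
Proof. by move=> Au; have := sa_lin a Au sa0; rewrite !addr0. Qed.

Lemma sa_fun u v w : A (u, v) -> A (u, w) -> v = w.
Proof. by have [[_ _ Afun] _ _] := A_sa; exact: Afun. Qed.

Lemma sa_sym u u' v v' : A (u, u') -> A (v, v') -> '[u', v] = '[u, v'].
Proof.
have [_ _ AA] := A_sa => Au; rewrite AA => Av.
exact: (Av _ Au).
Qed.

(** If u were nonzero, some v in the domain would satisfy |u - v| < |u|, while orthogonality gives
    |u - v|^2 = |u|^2 + |v|^2. *)
Lemma sa_dense u : (forall v v', A (v, v') -> '[u, v] = 0) -> u = 0.
Proof.
have [_ Ad _] := A_sa => uA; apply/eqP/negPn/negP => u0.
have hu : 0 < '|u|.
  by rewrite lt_def hnorm_ge0 andbT; apply: contra u0 => /eqP/hnorm_eq0/eqP.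
have [v [v' Av] ] := Ad u _ hu.
rewrite -(ltr_pXn2r (n := 2)) ?nnegrE ?hnorm_ge0 // !sqr_hnorm.
rewrite !(rdotDl, rdotDr, rdotNl, rdotNr) (rdotC dot v u).
have -> : rdot u v = 0 by rewrite /rdot (uA v v' Av).
by have := rdot_ge0 dot v; lra.
Qed.

Lemma domain_moment u :
  domain A u <-> (\int[dist u]_t (t ^+ 2)%:E < +oo)%E.
Proof. by have [-> _] := A_P. Qed.

Lemma domain_proj E u : measurable E -> domain A u -> domain A (P E u).
Proof.
move=> mE /domain_moment h; apply/domain_moment; apply: le_lt_trans h.
rewrite ge0_integral_proj //; last first.
- by move=> t; rewrite lee_fin sqr_ge0.
- exact/measurable_EFinP/measurable_funX.
apply: ge0_subset_integral => //; last by move=> t _; rewrite lee_fin sqr_ge0.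
exact/measurable_EFinP/measurable_funX.
Qed.

Lemma domain_bounded_proj E (M : R) u : measurable E ->
  (forall t, E t -> `|t| <= M) -> domain A (P E u).
Proof.
move=> mE EM; apply/domain_moment.
rewrite ge0_integral_proj //; last first.
- by move=> t; rewrite lee_fin sqr_ge0.
- exact/measurable_EFinP/measurable_funX.
apply: (@le_lt_trans _ _ (\int[dist u]_(t in E) (M ^+ 2)%:E)%E).
  apply: ge0_le_integral => //.
  - by move=> t _; rewrite lee_fin sqr_ge0.
  - by apply: measurableT_comp => //; exact: measurable_funX.
  - move=> t Et; rewrite lee_fin -real_normK ?num_real // ler_pXn2r ?nnegrE //.
      exact: EM.
    exact: le_trans (EM _ Et).
by rewrite integral_cst // -EFinM ltry.
Qed.

(** The spectral distribution is finite, and |t| <= 1 + t^2. *)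
Lemma domain_integrable u : domain A u ->
  (dist u).-integrable [set: R] (EFin \o (fun t => t)).
Proof.
move=> /domain_moment h.
have i1 : (dist u).-integrable [set: R] (EFin \o cst (1 : R)).
  apply: measurable_bounded_integrable => //; first exact: spectral_dist_lty.
  exact: bounded_cst.
have i2 : (dist u).-integrable [set: R] (EFin \o (fun t => t ^+ 2)).
  apply/integrableP; split; first exact/measurable_EFinP/measurable_funX.
  by under eq_integral do rewrite /= ger0_norm ?sqr_ge0//.
apply: le_integrable (integrableD measurableT i1 i2) => //=.
  exact/measurable_EFinP.
move=> t _; rewrite lee_fin [leRHS]ger0_norm ?addr_ge0 ?sqr_ge0 //.
rewrite -[t ^+ 2]real_normK ?num_real //.
by have := sqr_ge0 (`|t| - 1); rewrite sqrrB; nra.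
Qed.

Lemma sa_quad u v : A (u, v) -> rdot v u = \int[dist u]_t t.
Proof. by have [_ q] := A_P => Auv; rewrite /rdot q. Qed.

Lemma quad_split E u : measurable E -> domain A u ->
  \int[dist u]_t t = \int[dist (P E u)]_t t + \int[dist (P (~` E) u)]_t t.
Proof.
move=> mE du; have mC := measurableC mE.
rewrite -(setUv E) Rintegral_setU //; last first.
  - by apply/eqP; rewrite setICr.
  - by rewrite setUv; exact: domain_integrable.
  by rewrite /Rintegral setUv !integral_proj.
Qed.

(* The quadratic form of A splits over E and its complement, so its cross term
   vanishes. *)
Lemma sa_proj_orth E x x' y y' : measurable E -> A (x, x') -> A (y, y') ->
  P E x = x -> P (~` E) y = y -> '[x', y] = 0.
Proof.
move=> mE Ax Ay Px Py; have mC := measurableC mE.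
suff rorth z z' : A (z, z') -> P E z = z -> rdot z' y = 0.
  apply: dot_eq0; first exact: (rorth x).
  by apply: (rorth ('i *: x)); [exact: sa_Z | rewrite linearZ /= Px].
move=> Az Pz; have Azy := sa_D Az Ay.
have := sa_quad Azy; rewrite (quad_split mE); last by exists (z' + y').
have Py0 : P E y = 0 by rewrite -Py pvm_disjoint // setICr.
have Pz0 : P (~` E) z = 0 by rewrite -Pz pvm_disjoint // setICl.
rewrite (linearD (P E)) (linearD (P (~` E))) Pz Py Py0 Pz0 addr0 add0r
  -(sa_quad Az) -(sa_quad Ay).
rewrite !(rdotDl, rdotDr) => h.
have : rdot y' z = rdot z' y by rewrite /rdot (sa_sym Ay Az) -/(rdot _ _) rdotC.
by lra.
Qed.

Lemma sa_proj_inv E u v : measurable E -> A (P E u, v) -> P E v = v.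
Proof.
move=> mE Av; have mC := measurableC mE.
rewrite [RHS](@pvmC _ _ _ P E) // [X in _ + X](_ : _ = 0) ?addr0 //.
apply: sa_dense => w w' Aw.
have [z Az] : domain A (P (~` E) w) by apply: domain_proj => //; exists w'.
by rewrite pvm_sym // (sa_proj_orth mE Av Az) // pvm_idem.
Qed.

(** Split u along [E] and its complement. By [sa_proj_inv], A keeps each part in its own range, so
    P(E) picks out the image of the first part. *)
Lemma sa_proj E u v : measurable E -> A (u, v) -> A (P E u, P E v).
Proof.
move=> mE Av; have mC := measurableC mE.
have du : domain A u by exists v.
have [v1 A1] := domain_proj mE du; have [v2 A2] := domain_proj mC du.
have := sa_D A1 A2; rewrite -pvmC // => A12.
rewrite (sa_fun Av A12) linearD (sa_proj_inv mE A1).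
by rewrite -(sa_proj_inv mC A2) pvm_disjoint ?setICr // addr0.
Qed.

(** On the range of P(E) the quadratic form of A - a is the integral of t - a over [E], where |t -
    a| <= r. *)
Lemma proj_quad_bound E (a r : R) x v : measurable E ->
  (forall t, E t -> `|t - a| <= r) -> P E x = x -> A (x, v) ->
  `|rdot (v - a%:C *: x) x| <= r * rdot x x.
Proof.
move=> mE Er Px Av.
rewrite rdotDl rdotNl rdotZl (sa_quad Av).
have -> : \int[dist x]_t t = \int[dist x]_(t in E) t.
  by rewrite -{1}Px /Rintegral integral_proj.
have xE : fine (dist x E) = rdot x x by rewrite /= Px sqr_hnorm.
have it : (dist x).-integrable E (EFin \o (fun t => t)).
  by apply: integrableS (domain_integrable _) => //; exists v.
have ic (c : R) : (dist x).-integrable E (EFin \o cst c).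
  apply: measurable_bounded_integrable => //; first exact: spectral_dist_lty.
  exact: bounded_cst.
have h1 : \int[dist x]_(t in E) (a - r) <= \int[dist x]_(t in E) t.
  apply: le_Rintegral => //; first exact: ic.
  by move=> t /Er; rewrite ler_norml; lra.
have h2 : \int[dist x]_(t in E) t <= \int[dist x]_(t in E) (a + r).
  apply: le_Rintegral => //; first exact: ic.
  by move=> t /Er; rewrite ler_norml; lra.
move: h1 h2; rewrite !Rintegral_cst // xE ler_norml.
by set q := rdot x x; set I := Rintegral _ _ _ => h1 h2; apply/andP; split; nra.
Qed.

(* Polarization turns the bound on the quadratic form into an operator bound. *)
Lemma proj_bound E (a r : R) x v : measurable E -> 0 <= r ->
  (forall t, E t -> `|t - a| <= r) -> P E x = x -> A (x, v) ->
  '|v - a%:C *: x| <= r * '|x|.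
Proof.
move=> mE r0 Er Px Av; set w := v - a%:C *: x.
have Pw : P E w = w.
  have Pv : P E v = v by apply: (@sa_proj_inv _ x) => //; rewrite Px.
  by rewrite /w linearB linearZ /= Px Pv.
have [w0|w0] := eqVneq '|w| 0; first by rewrite w0 mulr_ge0 ?hnorm_ge0.
have p0 : 0 < '|w| by rewrite lt_def w0 hnorm_ge0.
have EM t : E t -> `|t| <= `|a| + r.
  move=> /Er tr; rewrite -[t](subrK a) addrC; apply: le_trans (ler_normD _ _) _.
  by rewrite lerD2l.
have pol y y' : P E y = y -> A (y, y') ->
    2 * rdot w y <= r * (rdot x x + rdot y y).
  move=> Py Ay.
  have Ap := sa_D Av Ay; have Am := sa_D Av (sa_Z (-1) Ay).
  have /(proj_quad_bound mE Er)/(_ Ap) : P E (x + y) = x + y.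
    by rewrite linearD Px Py.
  have /(proj_quad_bound mE Er)/(_ Am) : P E (x + (-1) *: y) = x + (-1) *: y.
    by rewrite linearD linearZ /= Px Py.
  rewrite !scaleN1r.
  have -> : v + y' - a%:C *: (x + y) = w + (y' - a%:C *: y).
    by rewrite /w scalerDr opprD addrACA.
  have -> : v - y' - a%:C *: (x - y) = w - (y' - a%:C *: y).
    by rewrite /w scalerBr !opprB addrACA [RHS]addrACA [- y' + _]addrC.
  have : rdot (y' - a%:C *: y) x = rdot w y.
    rewrite !(rdotDl, rdotNl, rdotZl) (rdotC dot y x).
    by rewrite (rdotC dot y') /rdot -(sa_sym Av Ay).
  set z := y' - _; rewrite !(rdotDl, rdotDr, rdotNl, rdotNr).
  by rewrite (rdotC dot y x) !ler_norml => -> /andP[h1 h2] /andP[h3 h4]; nra.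
have [w' Aw] : domain A w by rewrite -Pw; exact: domain_bounded_proj EM.
(* With y = s w the norms of x and y agree, and [pol] becomes |x| |w| <= r |x|^2. *)
set s : R := '|x| / '|w|.
have := pol _ _ _ (sa_Z s%:C Aw); rewrite linearZ /= Pw => /(_ erefl).
rewrite !(rdotZr, rdotZl) -!sqr_hnorm.
have -> : s * (s * '|w| ^+ 2) = '|x| ^+ 2.
  by rewrite /s; field.
have -> : 2 * (s * '|w| ^+ 2) = 2 * ('|x| * '|w|) by rewrite /s; field.
have [x0|x0] := eqVneq '|x| 0.
  move=> _; have x00 := hnorm_eq0 x0.
  have v0 : v = 0 by apply: sa_fun Av _; rewrite x00; exact: sa0.
  move: p0; rewrite /w v0 x00 scaler0 subrr.
  by rewrite /hnorm linear0l sqrtr0 ltxx.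
have x1 : 0 < '|x| by rewrite lt_def x0 hnorm_ge0.
move=> h; rewrite -(ler_pM2l x1); nra.
Qed.

(** From right to left this is [proj_bound] with radius 0. From left to right, let I be the interval
    of radius |l - t| / 2 around some t other than l: the norm of (A - t) P(I) u is |l - t| |P(I)
    u|, but [proj_bound] allows only half of that, so P(I) u = 0. Hence u has no mass off l. *)
Lemma eigen_proj (l : R) u : A (u, l%:C *: u) <-> P [set l] u = u.
Proof.
split=> [Au|Pu]; last first.
  have EM t : [set l] t -> `|t| <= `|l| by move=> ->.
  have [v Av] : domain A u by rewrite -Pu; exact: domain_bounded_proj EM.
  have El t : [set l] t -> `|t - l| <= 0 by move=> ->; rewrite subrr normr0.
  have := proj_bound (measurable_set1 l) (lexx 0) El Pu Av.
  rewrite mul0r => h; have {h} : '|v - l%:C *: u| = 0.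
    by apply/eqP; rewrite eq_le h hnorm_ge0.
  by move/hnorm_eq0/eqP; rewrite subr_eq0 => /eqP <-.
rewrite [RHS](@pvmC _ _ _ P [set l]) // [X in _ + X](_ : _ = 0) ?addr0 //.
apply: pvm_locally_null => [|t tl]; first exact: measurableC.
have p0 : 0 < `|l - t| by rewrite normr_gt0 subr_eq0; apply/eqP => ?; exact: tl.
exists (`|l - t| / 2); first by rewrite divr_gt0.
set r := `|l - t| / 2; set E : set R := `]t - r, t + r[%classic.
have mE : measurable E by exact: measurable_itv.
have Er (z : R) : E z -> `|z - t| <= r.
  by rewrite /E /= in_itv /= ler_norml => /andP[]; lra.
have r0 : 0 <= r by rewrite /r; lra.
have := proj_bound mE r0 Er (pvm_idem P u mE) (sa_proj mE Au).
rewrite (linearZ_LR (P E)) -scalerBl -rmorphB hnormZ /r.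
move=> h; apply: (@hnorm_eq0 _ _ dot); apply/eqP; rewrite eq_le hnorm_ge0 andbT.
have := hnorm_ge0 dot (P E u); move: h p0.
by set q := hnorm _ _; set p := `|_| => h p0 q0; nra.
Qed.

End SpectralTheory.

(** * Locally finite spectrum *)

Section DiscreteSpectrum.
Set Implicit Arguments.
Unset Strict Implicit.
Variables (R : realType) (H : lmodType R[i]) (dot : {dot H for conjC}).
Variables (A : set (H * H)) (P : pvm dot).
Hypotheses (A_sa : self_adjoint dot A) (A_P : spectral_measure A P).
Implicit Types (u v w x y : H) (E F : set R).
Local Notation "''[' u , v ]" := (dot u v) : ring_scope.
Local Notation "''|' u |" := (hnorm dot u) (at level 0, format "''|' u |").

Definition eigenvalue_of (l : R[i]) := exists2 u, u != 0 & A (u, l *: u).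

Lemma eigenvalue_real (l : R[i]) : eigenvalue_of l -> l = (Re l)%:C.
Proof.
move=> [u u0 Au]; have := sa_sym A_sa Au Au; rewrite dotZl dotZr.
move=> /(mulIf _); rewrite dnorm_eq0 => /(_ u0) h.
apply: complex_ext => //=; have /(congr1 (@Im R)) := h.
by rewrite ImJ; lra.
Qed.

Lemma eigenvalue_spectrum (l : R[i]) : eigenvalue_of l -> spectrum dot A l.
Proof.
move=> [u u0 Au] [S [_ SP]]; have := (SP u 0).1; rewrite add0r linear0 => /(_ Au).
by apply/eqP.
Qed.

Lemma range_eigenproj (l : R) :
  range (P [set l]) = [set u | A (u, l%:C *: u)].
Proof.
apply/seteqP; split=> [_ [u _ <-]|u /(eigen_proj A_sa A_P) uE]; last by exists u.
by apply/(eigen_proj A_sa A_P); rewrite pvm_idem.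
Qed.

(** For x = P(E) u the resolvent bound and [proj_bound] give |x| <= M |(A - l) x| <= |M| r |x|. The
    radius r is chosen with |M| r <= 1/2; the added 1 covers M = 0. *)
Lemma resolvent_null (l : R) : resolvent_set dot A l%:C ->
  exists2 e : R, 0 < e & forall u, P `]l - e, l + e[%classic u = 0.
Proof.
move=> [S [[M SM] SP]]; pose r : R := (2 * (`|M| + 1))^-1.
have M0 : 0 < `|M| + 1 by rewrite ltr_wpDl.
have r0 : 0 < r by rewrite invr_gt0 mulr_gt0.
exists r => // u; set E : set R := `]l - r, l + r[%classic.
have mE : measurable E by exact: measurable_itv.
have Er (z : R) : E z -> `|z - l| <= r.
  by rewrite /E /= in_itv /= ler_norml => /andP[]; lra.
have EM (z : R) : E z -> `|z| <= `|l| + r.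
  move=> /Er zr; rewrite -[z](subrK l) addrC; apply: le_trans (ler_normD _ _) _.
  by rewrite lerD2l.
have [v Av] := domain_bounded_proj A_P u mE EM.
set x := P E u in Av *.
have xE : x = S (v - l%:C *: x) by apply/SP; rewrite subrK.
have h1 := proj_bound A_sa A_P mE (ltW r0) Er (pvm_idem P u mE) Av.
have h2 : '|x| <= M * '|v - l%:C *: x| by rewrite {1}xE.
have h3 : `|M| * r <= 2^-1.
  rewrite /r invfM mulrCA ler_piMr ?invr_ge0 // -ler_pdivlMr ?invr_gt0 //.
  by rewrite div1r invrK lerDl.
apply: (@hnorm_eq0 _ _ dot); apply/eqP; rewrite eq_le hnorm_ge0 andbT.
have := hnorm_ge0 dot x; have := hnorm_ge0 dot (v - l%:C *: x).
have : M <= `|M| := ler_norm M; have : 0 <= `|M| := normr_ge0 M.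
move: h1 h2 h3; set a := hnorm _ _; set b := hnorm _ _; set m := `|M|.
move=> h1 h2 h3 m0 mM a0 b0.
have h4 : b <= m * a by apply: le_trans h2 _; exact: ler_wpM2r.
have h5 : m * a <= m * (r * b) by exact: ler_wpM2l.
have h6 : m * r * b <= 2^-1 * b by exact: ler_wpM2r.
by lra.
Qed.

(** The rest of this section is abstract: the differential operator enters only through [resolventP]
    and [local_dim], established later by means of [det_charmx_resolvent] and
    [eigenprojection_local_dim]. *)
Hypothesis resolventP : forall l : R,
  ~ eigenvalue_of l%:C -> resolvent_set dot A l%:C.

Variables (n : nat) (delta : R).
Hypothesis delta0 : 0 < delta.
Hypothesis local_dim : forall (a : R) (x : 'I_n.+1 -> H),
  (forall i, P `[a - delta, a + delta]%classic (x i) = x i) ->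
  exists2 c : 'I_n.+1 -> R[i], \sum_i c i *: x i = 0 & exists i, c i != 0.

Let sigma : set R := [set l | eigenvalue_of l%:C].

Lemma spectrum_eigenvalue : [set l : R | spectrum dot A l%:C] = sigma.
Proof.
apply/seteqP; split=> l /=; last exact: eigenvalue_spectrum.
by apply: contra_notP; exact: resolventP.
Qed.

(** Eigenvectors of n + 1 distinct eigenvalues in the window would satisfy a nontrivial linear
    relation by [local_dim]; applying P({l_i}) to it isolates the i-th term and forces its
    coefficient to be 0. *)
Lemma eigenvalues_locally_finite (a : R) :
  finite_set (sigma `&` `[a - delta, a + delta]).
Proof.
apply: contrapT => inf.
have [B BS Bn] := infinite_set_fset n.+1 inf.
pose s := finmap.enum_fset B.
have lS (i : 'I_n.+1) : (sigma `&` `[a - delta, a + delta]) (nth 0 s i).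
  by apply: BS => /=; apply: mem_nth; exact: leq_trans (ltn_ord i) _.
pose l (i : 'I_n.+1) := nth 0 s i.
have l_inj : injective l.
  move=> i j /eqP; rewrite nth_uniq ?finmap.fset_uniq //;
    try exact: leq_trans (ltn_ord _) _.
  by move=> /eqP /val_inj.
have /choice [x xP] : forall i, exists x, x != 0 /\ A (x, (l i)%:C *: x).
  by move=> i; have [[x x0 Ax] _] := lS i; exists x.
have Px i : P [set l i] (x i) = x i.
  by apply/(eigen_proj A_sa A_P); have [] := xP i.
have Pxj i j : i != j -> P [set l j] (x i) = 0.
  move=> ij; rewrite -(Px i) pvm_disjoint //.
  apply/seteqP; split=> // t [/= -> /l_inj ji]; by rewrite ji eqxx in ij.
have [|c c0 [i /eqP[]]] := @local_dim a x.
  move=> i; rewrite -(Px i) pvmI //.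
  by rewrite setIidr // => t ->; have [] := lS i.
move/(congr1 (P [set l i])): c0; rewrite linear0 linear_sum (bigD1 i) //= big1.
  rewrite addr0 linearZ /= Px => /eqP; rewrite scaler_eq0.
  by have [/negPf -> _] := xP i; rewrite orbF => /eqP.
by move=> j ji; rewrite linearZ /= Pxj // scaler0.
Qed.

(** The finitely many eigenvalues other than t in the window around t form a closed set. *)
Lemma eigenvalues_isolated (t : R) : exists2 e : R, 0 < e &
  forall s : R, sigma s -> `|s - t| < e -> s = t.
Proof.
have fin : finite_set ((sigma `&` `[t - delta, t + delta]) `\ t).
  by apply: sub_finite_set (eigenvalues_locally_finite t); exact: subDsetl.
have cl : closed ((sigma `&` `[t - delta, t + delta]) `\ t).
  by apply: (accessible_finite_set_closed.1 _ _ fin);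
    exact: hausdorff_accessible (@Rhausdorff R).
have : nbhs t (~` ((sigma `&` `[t - delta, t + delta]) `\ t)).
  by apply: open_nbhs_nbhs; split; [exact: closed_openC | move=> [_ []] ].
move=> /nbhs_ballP[e /= e0 eP]; exists (Num.min e delta).
  by rewrite lt_min e0.
move=> s ss; rewrite lt_min => /andP[se sd].
have := eP s; rewrite /ball /= distrC => /(_ se) ns.
apply: contrapT => st; apply: ns; split => //; split => //=.
by rewrite in_itv /=; move: sd; rewrite ltr_norml; lra.
Qed.

Lemma eigenvalues_limit_point : limit_point sigma = set0.
Proof.
apply/seteqP; split=> // t tl; have [e e0 te] := eigenvalues_isolated t.
have [s [/eqP st ss]] := tl _ (nbhsx_ballx t e e0).
by rewrite /ball /= distrC => /(te _ ss).
Qed.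

Lemma pvm_null_resolvent E : measurable E -> E `&` sigma = set0 -> pvm_null P E.
Proof.
move=> mE Es u; apply: pvm_locally_null => // t Et.
have [|e e0 h] := @resolvent_null t.
  apply: resolventP => st.
  by have : (E `&` sigma) t by []; rewrite Es.
by exists e.
Qed.

(** Otherwise u has no mass near any t in [E]: an isolating interval consists of t itself and a part
    free of eigenvalues. Then P(E) u = 0. *)
Lemma pvm_eigenvalue_atom E u : measurable E -> P E u != 0 ->
  exists2 l, E l & P [set l] u != 0.
Proof.
move=> mE; apply: contra_neqP => h.
have {}h l : E l -> P [set l] u = 0.
  by move=> El; apply/eqP/negPn/negP => hl; apply: h; exists l.
apply: pvm_locally_null => // t Et.
have [e e0 te] := eigenvalues_isolated t; exists e => //.
set I : set R := `]t - e, t + e[%classic.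
have mI : measurable I by exact: measurable_itv.
have tI : [set t] `<=` I by move=> _ ->; rewrite /I /= in_itv /=; lra.
rewrite -(setUIDK I [set t]) (setIidr tI) pvmU //; last 2 first.
- exact: measurableD.
- by rewrite setDE setICA setICr setI0.
rewrite h // add0r; apply: pvm_null_resolvent; first exact: measurableD.
apply/seteqP; split=> // s [[sI st] ss]; apply: st; apply: te => //.
by move: sI; rewrite /I /= in_itv /= ltr_norml; lra.
Qed.

Lemma pvm_atomic : atomic P.
Proof.
move=> E mE nE.
have [u uE] : exists u, P E u != 0.
  by apply: contra_notP nE => h u; apply/eqP/negPn/negP => hu; apply: h; exists u.
have [l El lu] := pvm_eigenvalue_atom mE uE.
exists [set l]; first by move=> _ ->.
split=> //; first by move=> /(_ u) /eqP; rewrite (negPf lu).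
move=> F mF Fl; have [Fl'|nFl] := pselect (F l); [right|left].
  suff -> : [set l] `\` F = set0 by move=> v; rewrite pvm0.
  by apply/seteqP; split=> // t [-> ].
suff -> : F = set0 by move=> v; rewrite pvm0.
by apply/seteqP; split=> // t Ft; have tl := Fl _ Ft; rewrite tl in Ft.
Qed.

(** Projections of non-Borel sets are junk, so the complement of [sigma] must be shown measurable
    before [P] is evaluated there; countability gives this. *)
Lemma eigenvalues_countable : countable sigma.
Proof.
have -> : sigma = \bigcup_(q : rat) (sigma `&` `[ratr q - delta, ratr q + delta]).
  apply/seteqP; split=> [t st|t [q _ []] //].
  have [q] : exists q : rat, ratr q \in `]t - delta, t[.
    by apply: rat_in_itvoo; rewrite ltrBlDr ltrDl.
  rewrite in_itv /= => /andP[q1 q2]; exists q => //; split=> //=.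
  by rewrite in_itv /=; lra.
apply: bigcup_countable => // q _; apply: finite_set_countable.
exact: eigenvalues_locally_finite.
Qed.

Lemma measurable_eigenvalues : measurable sigma.
Proof. exact: countable_measurable eigenvalues_countable. Qed.

Lemma eigenvalues_bounded_domain : bounded_set sigma -> forall u, domain A u.
Proof.
(* [bounded_set] grants the bound only for reals strictly above [M]. *)
move=> [M [_ /(_ (M + 1))]]; rewrite ltrDl ltr01 => /(_ erefl) sM u.
have mI : measurable (`[- (M + 1), M + 1]%classic : set R) by exact: measurable_itv.
rewrite (@pvmC _ _ _ P `[- (M + 1), M + 1]%classic u) //.
rewrite [X in _ + X]pvm_null_resolvent; last 2 first.
- exact: measurableC.
- apply/seteqP; split=> // t [tI /sM h]; apply: tI.
  by move: h; rewrite /= in_itv /= ler_norml.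
rewrite addr0; apply: (domain_bounded_proj A_P (M := M + 1)) => //.
by move=> t; rewrite /= in_itv /= -ler_norml.
Qed.

End DiscreteSpectrum.

(** * Complex exponentials and primitives *)

Section ComplexExponential.
Set Implicit Arguments.
Unset Strict Implicit.
Variable R : realType.
Implicit Types (z w l : R[i]) (x y : R) (f g : R -> R[i]).

Lemma normcE z : normc z = Num.sqrt (Re z ^+ 2 + Im z ^+ 2).
Proof. by case: z. Qed.

Lemma normc_ge0 z : 0 <= normc z. Proof. by rewrite normcE sqrtr_ge0. Qed.

Lemma normc_leD z w : normc (z + w) <= normc z + normc w.
Proof. exact: le_normcD. Qed.

Lemma abs_Re_le z : `|Re z| <= normc z.
Proof. by rewrite normcE -sqrtr_sqr ler_wsqrtr // lerDl sqr_ge0. Qed.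

Lemma abs_Im_le z : `|Im z| <= normc z.
Proof. by rewrite normcE -sqrtr_sqr ler_wsqrtr // lerDr sqr_ge0. Qed.

Lemma normc_le_ReIm z : normc z <= `|Re z| + `|Im z|.
Proof.
rewrite -(@ler_pXn2r _ 2) ?nnegrE ?normc_ge0 ?addr_ge0 // sqr_normcE.
rewrite -[Re z ^+ 2]real_normK ?num_real // -[Im z ^+ 2]real_normK ?num_real //.
by have := normr_ge0 (Re z); have := normr_ge0 (Im z); nra.
Qed.

(** Unlike the total function [cderive], this relation asserts that the derivative exists. *)
Definition cder f x (z : R[i]) : Prop :=
  is_derive x 1 (fun t => Re (f t)) (Re z) /\
  is_derive x 1 (fun t => Im (f t)) (Im z).

Lemma cderD f g x z w : cder f x z -> cder g x w ->
  cder (fun t => f t + g t) x (z + w).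
Proof.
move=> [f1 f2] [g1 g2]; rewrite /cder !(ReD, ImD); split.
- by under [fun t => Re _]eq_fun do rewrite ReD; exact: is_deriveD.
- by under [fun t => Im _]eq_fun do rewrite ImD; exact: is_deriveD.
Qed.

Lemma cderM f g x z w : cder f x z -> cder g x w ->
  cder (fun t => f t * g t) x (f x * w + z * g x).
Proof.
move=> [f1 f2] [g1 g2]; rewrite /cder; split.
- under [fun t => Re _]eq_fun do rewrite ReM.
  apply: is_derive_eq; rewrite /GRing.scale /= !(ReD, ReM); ring.
- under [fun t => Im _]eq_fun do rewrite ImM.
  apply: is_derive_eq; rewrite /GRing.scale /= !(ImD, ImM); ring.
Qed.

Lemma cder_cst z x : cder (fun=> z) x 0.
Proof. by split; exact: is_derive_cst. Qed.

Lemma cder_near f g x z : (\forall t \near x, f t = g t) ->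
  cder f x z -> cder g x z.
Proof.
move=> fg [f1 f2]; split.
- apply: near_eq_is_derive f1; near=> t; congr Re.
  by near: t; exact: fg.
- apply: near_eq_is_derive f2; near=> t; congr Im.
  by near: t; exact: fg.
Unshelve. all: by end_near. Qed.

Lemma cder_cderive f x z : cder f x z -> cderive f x = z.
Proof.
move=> [f1 f2]; apply: complex_ext => /=; rewrite derive1E;
  exact: derive_val.
Qed.

Definition ccontinuous f : Prop :=
  continuous (fun x : R => Re (f x)) /\ continuous (fun x : R => Im (f x)).

Lemma ccontinuous_cst z : ccontinuous (fun=> z).
Proof. by split=> x; exact: cvg_cst. Qed.

Lemma ccontinuousD f g : ccontinuous f -> ccontinuous g ->
  ccontinuous (fun x => f x + g x).
Proof.
move=> [r1 j1] [r2 j2]; split=> x.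
- by under eq_fun do rewrite ReD; apply: cvgD; [exact: r1|exact: r2].
- by under eq_fun do rewrite ImD; apply: cvgD; [exact: j1|exact: j2].
Qed.

Lemma ccontinuousM f g : ccontinuous f -> ccontinuous g ->
  ccontinuous (fun x => f x * g x).
Proof.
move=> [r1 j1] [r2 j2]; split=> x.
- under eq_fun do rewrite ReM.
  by apply: cvgB; apply: cvgM; [exact: r1|exact: r2|exact: j1|exact: j2].
- under eq_fun do rewrite ImM.
  by apply: cvgD; apply: cvgM; [exact: r1|exact: j2|exact: j1|exact: r2].
Qed.

Lemma cder_continuous f f' : (forall x, cder f x (f' x)) -> ccontinuous f.
Proof.
move=> df; split=> x; have [d1 d2] := df x;
  by apply/differentiable_continuous/derivable1_diffP/ex_derive.
Qed.

Definition cexpl l x : R[i] := cexp (two_pi_i R * (l * x%:C)).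

Lemma cexpD z w : cexp (z + w) = cexp z * cexp w.
Proof.
rewrite /cexp ReD ImD expRD cosD sinD.
apply: complex_ext; rewrite !(ReM, ImM) /=; ring.
Qed.

Lemma cexp0 : cexp (0 : R[i]) = 1.
Proof. by rewrite /cexp /= expR0 cos0 sin0; apply: complex_ext => /=; ring. Qed.

Lemma cexplN l x : cexpl l x * cexpl (- l) x = 1.
Proof. by rewrite /cexpl -cexpD mulNr mulrN subrr cexp0. Qed.

Lemma cexpl_neq0 l x : cexpl l x != 0.
Proof.
by apply/eqP => h; have := cexplN l x; rewrite h mul0r => /esym/eqP;
  rewrite oner_eq0.
Qed.

Lemma normc_cexp z : normc (cexp z) = expR (Re z).
Proof.
rewrite normcE /cexp ReM ImM /= !mul0r subr0 addr0 !exprMn -mulrDr.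
by rewrite cos2Dsin2 mulr1 sqrtr_sqr ger0_norm // expR_ge0.
Qed.

Lemma normc_cexpl_real (l x : R) : normc (cexpl l%:C x) = 1.
Proof.
rewrite normc_cexp (_ : Re _ = 0) ?expR0 // !(ReM, ImM) /=; ring.
Qed.

Lemma cexplE l x : let p := - (2 * pi * Im l) in let q := 2 * pi * Re l in
  cexpl l x = (expR (p * x) * cos (q * x)) +i* (expR (p * x) * sin (q * x)).
Proof.
move=> p q; rewrite /cexpl /cexp; set z := two_pi_i R * _.
have -> : Re z = p * x by rewrite /z !(ReM, ImM) /= /p; ring.
have -> : Im z = q * x by rewrite /z !(ReM, ImM) /= /q; ring.
by apply: complex_ext; rewrite !(ReM, ImM) /= mul0r ?subr0 ?addr0.
Qed.

Lemma conjc_cexpl l x : conjc (cexpl l x) = cexpl (- conjc l) x.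
Proof.
rewrite !cexplE; case: l => a b /=; rewrite opprK.
by rewrite mulrN !mulNr cosN sinN mulrN.
Qed.

Lemma conjc_cexpl_real (l x : R) : conjc (cexpl (- l%:C) x) = cexpl l%:C x.
Proof.
rewrite conjc_cexpl (_ : - conjc (- l%:C) = l%:C) //.
by apply: complex_ext; rewrite ?Re_opp ?Im_opp ?ReJ ?ImJ ?Re_opp ?Im_opp /=
  ?opprK ?oppr0.
Qed.

Lemma cder_cexpl l x : cder (cexpl l) x (two_pi_i R * l * cexpl l x).
Proof.
set p := - (2 * pi * Im l); set q := 2 * pi * Re l.
have eE : cexpl l = fun x => (expR (p * x) * cos (q * x)) +i* (expR (p * x) *
  sin (q * x)).
  by apply/funext => t; rewrite cexplE.
have De : is_derive x 1 (fun t => expR (p * t)) (p * expR (p * x)).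
  by apply: is_derive_eq; rewrite /GRing.scale /=; ring.
have Dc : is_derive x 1 (fun t => cos (q * t)) (- q * sin (q * x)).
  by apply: is_derive_eq; rewrite /GRing.scale /=; ring.
have Ds : is_derive x 1 (fun t => sin (q * t)) (q * cos (q * x)).
  by apply: is_derive_eq; rewrite /GRing.scale /=; ring.
rewrite eE; split; apply: is_derive_eq;
  rewrite /GRing.scale !(ReM, ImM) /= /p /q; ring.
Qed.

End ComplexExponential.

(** * Primitives of integrable functions and absolute continuity *)

Section Primitive.
Set Implicit Arguments.
Unset Strict Implicit.
Variable R : realType.
Implicit Types (f k : R -> R[i]) (K : R -> R).
Local Notation mu := (@lebesgue_measure R).

(** Integrating from minus infinity serves all intervals J_i at once; the base point cancels in
    [increment]. *)
Definition prim k (x : R) : R[i] :=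
  (\int[mu]_(t in `]-oo, x]) Re (k t)) +i* (\int[mu]_(t in `]-oo, x]) Im (k t)).

Definition cintegrable k : Prop :=
  mu.-integrable [set: R] (EFin \o (fun t => Re (k t))) /\
  mu.-integrable [set: R] (EFin \o (fun t => Im (k t))).

Lemma integrable_derive (h : R -> R) : mu.-integrable [set: R] (EFin \o h) ->
  {ae mu, forall x, is_derive (x : R) 1
    (fun y : R => \int[mu]_(t in `]-oo, y]) h t) (h x)}.
Proof.
move=> ih.
have ihy y : mu.-integrable `]-oo, y] (EFin \o h) by exact: integrableS ih.
have lh : locally_integrable [set: R] h.
  by have := integrable_locally measurableT ih; rewrite patch_setT.
have := FTC1Ny ihy lh.
apply: filterS; first exact: (ae_filter_ringOfSetsType mu).
move=> x [d1 d2].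
by apply: DeriveDef; [exact: d1 | rewrite -derive1E; exact: d2].
Qed.

Lemma prim_cder k : cintegrable k -> {ae mu, forall x, cder (prim k) x (k x)}.
Proof.
move=> [ire iim]; have := integrable_derive iim.
have := integrable_derive ire.
apply: filterS2; first exact: (ae_filter_ringOfSetsType mu).
by move=> x h1 h2; split.
Qed.

Lemma Rintegral_itvNyB (h : R -> R) (x y : R) : x <= y ->
  mu.-integrable [set: R] (EFin \o h) ->
  \int[mu]_(t in `]-oo, y]) h t - \int[mu]_(t in `]-oo, x]) h t =
  \int[mu]_(t in `]x, y]) h t.
Proof.
by move=> xy ih; apply: Rintegral_itvB => //; exact: integrableS ih.
Qed.

(** A majorant of |k| that is integrable as soon as the two components are. *)
Definition density k t := `|Re (k t)| + `|Im (k t)|.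

Lemma density_ge0 k t : 0 <= density k t.
Proof. by rewrite addr_ge0. Qed.

Lemma integrable_density k : cintegrable k ->
  mu.-integrable [set: R] (EFin \o density k).
Proof.
by move=> [ire iim]; apply: integrableD (integrable_norm ire) (integrable_norm iim).
Qed.

Lemma prim_incr k (x y : R) : cintegrable k -> x <= y ->
  normc (prim k y - prim k x) <= \int[mu]_(t in `]x, y]) density k t.
Proof.
move=> ik xy; have [ire iim] := ik.
have iS (h : R -> R) : mu.-integrable [set: R] (EFin \o h) ->
    mu.-integrable `]x, y] (EFin \o h) by exact: integrableS.
apply: le_trans (normc_le_ReIm _) _; rewrite ReD ImD Re_opp Im_opp/=.
rewrite !Rintegral_itvNyB // /density RintegralD //; last 2 first.
- by apply: iS; exact: integrable_norm.
- by apply: iS; exact: integrable_norm.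
by apply: lerD; apply: le_normr_Rintegral => //; exact: iS.
Qed.

(** A sufficient condition for absolute continuity, shaped for a primitive times an exponential: the
    integral controls the former, the Lipschitz term the latter. *)
Definition dominated f (a b : R) : Prop :=
  exists K (L : R), [/\ mu.-integrable [set: R] (EFin \o K), 0 <= L &
    forall x y, a < x -> x <= y -> y < b ->
      normc (f y - f x) <= \int[mu]_(t in `]x, y]) `|K t| + L * (y - x)].

(** Half of e is spent on the integral of |K| over a set of small measure, the other half on [L]
    times the total length. *)
Lemma dominated_ac f (a b : R) : dominated f a b -> absolutely_continuous f a b.
Proof.
move=> [K [L [iK L0 fK]]] e e0.
have e2 : 0 < e / 2 by rewrite divr_gt0.
have [d [d0 dP]] := integral_normr_continuous iK e2.
have L1 : 0 < 2 * (L + 1) by rewrite mulr_gt0 // ltr_wpDl.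
(* [L + 1] keeps the denominator positive when [L] is 0. *)
exists (Num.min d (e / (2 * (L + 1)))); first by rewrite lt_min d0 divr_gt0.
move=> m x y xy tr; rewrite lt_min => /andP[sd sL].
pose I (i : nat) : set (measurableTypeR R) := `]x i, y i[%classic.
have mI i : measurable (I i) by exact: measurable_itv.
have iKI (D : set (measurableTypeR R)) : measurable D ->
    mu.-integrable D (EFin \o (fun t => `|K t|)).
  by move=> mD; apply: integrableS (integrable_norm iK).
have le1 : \sum_(i < m) normc (f (y i) - f (x i)) <=
    \sum_(i < m) (\int[mu]_(t in I i) `|K t| + L * (y i - x i)).
  apply: ler_sum => i _; have [ax [xy' yb]] := xy i (ltn_ord i).
  by rewrite Rintegral_itv_bndo_bndc; [exact: fK | exact: iKI].
apply: le_lt_trans le1 _; rewrite big_split /= -mulr_sumr.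
have -> : \sum_(i < m) \int[mu]_(t in I i) `|K t| =
    \int[mu]_(t in \big[setU/set0]_(i < m) I i) `|K t|.
  rewrite sum_fine => [|i _]; last first.
    exact: (integrable_fin_num (mI i) (iKI _ (mI i))).
  rewrite /Rintegral ge0_integral_bigsetU //.
  - exact: index_enum_uniq.
  - by move=> i j _ _ ij; apply/val_inj/tr => /=.
  - apply: (@measurable_int _ _ _ mu); apply: iKI.
    by apply: bigsetU_measurable => i _; exact: mI.
have h1 : L * \sum_(i < m) (y i - x i) < e / 2.
  move: sL; rewrite ltr_pdivlMr // => sL.
  have s0 : 0 <= \sum_(i < m) (y i - x i).
    by apply: sumr_ge0 => i _; rewrite subr_ge0; have [_ []] := xy i (ltn_ord i).
  rewrite ltr_pdivlMr //; nra.
have h2 : \int[mu]_(t in \big[setU/set0]_(i < m) I i) `|K t| < e / 2.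
  apply: dP; first by apply: bigsetU_measurable => i _; exact: mI.
  apply: le_lt_trans (Boole_inequality _ _) _; first by move=> i _; exact: mI.
  rewrite (eq_bigr (fun i : 'I_m => (y i - x i)%:E)) => [|i _].
    by rewrite sumEFin lte_fin.
  rewrite [LHS]lebesgue_measure_itv /= lte_fin; have [_ [xy' _]] := xy i (ltn_ord i).
  move: xy'; rewrite le_eqVlt => /predU1P[->|->]; last by [].
  by rewrite ltxx subrr.
by rewrite [ltRHS]splitr; exact: ltrD.
Qed.

Lemma absolutely_continuous_dist f (a b : R) : absolutely_continuous f a b ->
  forall e : R, 0 < e -> exists2 d : R, 0 < d & forall x y, a < x < b -> a < y < b ->
    `|x - y| < d -> normc (f x - f y) < e.
Proof.
move=> ac e e0; have [d d0 dP] := ac e e0; exists d => // x y.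
wlog xy : x y / x <= y.
  move=> h xb yb xyd; have [xy|yx] := leP x y; first exact: h.
  by rewrite -normcN opprB; apply: h => //; [exact: ltW | rewrite distrC].
move=> /andP[ax xb] /andP[ay yb]; rewrite distrC ger0_norm ?subr_ge0 // => yxd.
have := dP 1%N (fun=> x) (fun=> y); rewrite !big_ord1 => h.
rewrite -normcN opprB; apply: h => //.
by move=> i j /= ; rewrite !ltnS !leqn0 => /eqP -> /eqP ->.
Qed.

End Primitive.

(** * Square-integrable functions on Omega *)

Section SquareIntegrableClasses.
Set Implicit Arguments.
Unset Strict Implicit.
Context d (T : measurableType d) (R : realType).
Variable mu : {measure set T -> \bar R}.
Implicit Types (f g : T -> R[i]) (u v : L2 mu).

Lemma L2_class f : square_integrable mu f -> exists u : L2 mu, represents u f.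
Proof.
move=> sf; have fP : f \in L2pred mu by exact: mem_set.
by exists (\pi_(L2 mu) (MkL2fun fP))%qT; exact: L2_reprE.
Qed.

Lemma represents_lin (a : R[i]) u v f g : represents u f -> represents v g ->
  represents (a *: u + v) (fun x => a * f x + g x).
Proof.
move=> uf vg; have := L2_linE a u v.
apply: filterS3 uf vg => x /(_ I) ufx /(_ I) vgx /(_ I) h _.
by rewrite h -ufx -vgx.
Qed.

Lemma represents0 : represents (0 : L2 mu) (fun=> 0).
Proof. exact: L2_0E. Qed.

Lemma represents_scale (a : R[i]) u f : represents u f ->
  represents (a *: u) (fun x => a * f x).
Proof.
move=> uf; have := represents_lin a uf represents0; rewrite addr0.
by apply: filterS => x h _; rewrite h ?addr0.
Qed.

Lemma represents_inj u v f : represents u f -> represents v f -> u = v.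
Proof.
move=> uf vf; apply: L2_eqP.
by apply: filterS2 uf vf => x /(_ I) -> /(_ I) ->.
Qed.

Lemma represents_ae u f g : {ae mu, forall x, f x = g x} ->
  represents u f -> represents u g.
Proof.
by move=> fg; apply: filterS2 fg => x <- uf _; exact: uf.
Qed.

Lemma represents_ae_eq u f g : represents u f -> represents u g ->
  {ae mu, forall x, f x = g x}.
Proof.
by move=> uf ug; apply: filterS2 uf ug => x /(_ I) <- /(_ I).
Qed.

Lemma l2dot_represents u v f g : cmeasurable f -> cmeasurable g ->
  represents u f -> represents v g ->
  l2dot u v = (\int[mu]_x Re (f x * conjc (g x))) +i*
              (\int[mu]_x Im (f x * conjc (g x))).
Proof.
move=> [rf jf] [rg jg] uf vg.
have [ir ij] := integrable_mulJ (L2_sqint u) (L2_sqint v).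
apply: complex_ext => /=; congr fine; apply: ae_eq_integral => //.
- exact: measurable_int ir.
- apply/measurable_EFinP; under eq_fun do rewrite ReM ReJ ImJ mulrN opprK.
  by apply: measurable_funD => //; apply: measurable_funM.
- by apply: filterS2 uf vg => x /(_ I) -> /(_ I) -> _.
- exact: measurable_int ij.
- apply/measurable_EFinP; under eq_fun do rewrite ImM ReJ ImJ mulrN addrC.
  by apply: measurable_funB => //; apply: measurable_funM.
- by apply: filterS2 uf vg => x /(_ I) -> /(_ I) -> _.
Qed.

End SquareIntegrableClasses.

(** * Lebesgue measure restricted to Omega *)

Section LebesgueOmega.
Set Implicit Arguments.
Unset Strict Implicit.
Variables (R : realType) (n : nat) (alpha beta : 'I_n -> R).
Local Notation mu := (@lebesgue_measure R).
Local Notation nu := (lebesgue_Omega alpha beta).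
Local Notation Om := (Omega alpha beta).
Local Notation H := (L2 nu).
Local Notation dot := (dot_Omega alpha beta).
Local Notation hn := (hnorm dot).
Implicit Types (f g : R -> R[i]) (u v : H).

(** The complement of Omega is null for the restricted measure, so membership in Omega can be
    added. *)
Lemma ae_lebesgue_Omega (Q : R -> Prop) :
  {ae mu, forall x, Q x} -> {ae nu, forall x, Om x /\ Q x}.
Proof.
move=> [N [mN N0 QN]].
have mO : measurable (Om : set (measurableTypeR R)) := measurable_Omega alpha beta.
exists (N `|` ~` Om); split.
- by apply: measurableU => //; exact: measurableC.
- rewrite -[LHS]/(mu ((N `|` ~` Om) `&` Om)) setIUl setICl setU0.
  apply/eqP; rewrite eq_le measure_ge0 andbT -N0.
  by apply: le_measure; rewrite ?inE //; exact: measurableI.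
- move=> x nQ; have [Nx|nN] := pselect (N x); first by left.
  right=> Ox; apply: nQ; split=> //; apply: contrapT => nq; apply: nN.
  exact: QN.
Qed.

Lemma integral_lebesgue_Omega (h : R -> \bar R) : measurable_fun [set: R] h ->
  (\int[nu]_x h x = \int[mu]_(x in Om) h x)%E.
Proof.
have mO : measurable (Om : set (measurableTypeR R)) := measurable_Omega alpha beta.
have ge0 (k : R -> \bar R) : measurable_fun [set: R] k -> (forall x, 0 <= k x)%E ->
    (\int[nu]_x k x = \int[mu]_(x in Om) k x)%E.
  move=> mk k0; rewrite (@ge0_negligible_integral _ (measurableTypeR R) _ nu _
    (~` Om)) //; last 2 first.
  - exact: measurableC.
  - by rewrite -[LHS]/(mu (~` Om `&` Om)) setICl measure0.
  rewrite setTD setCK; apply: eq_measure_integral => F mF FO.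
  by rewrite -[LHS]/(mu (F `&` Om)) (setIidl FO).
move=> mh; rewrite integralE [RHS]integralE; congr (_ - _)%E.
  by apply: ge0 => //; exact: measurable_funepos.
by apply: ge0 => //; exact: measurable_funeneg.
Qed.

Lemma integrable_lebesgue_Omega (h : R -> R) :
  nu.-integrable [set: R] (EFin \o h) ->
  mu.-integrable [set: R] (EFin \o (fun x => h x * \1_Om x)).
Proof.
have mO : measurable (Om : set (measurableTypeR R)) := measurable_Omega alpha beta.
move=> /integrableP[mh ih].
have iO : mu.-integrable Om (EFin \o h).
  apply/integrableP; split; first exact: measurable_funTS.
  by rewrite -integral_lebesgue_Omega //; exact: measurableT_comp.
have := (integrable_mkcond _ mO).1 iO; congr (_.-integrable _ _).
apply/funext => x; rewrite patchE /= indicE.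
by case: ifPn => _; rewrite ?mulr1 ?mulr0.
Qed.

End LebesgueOmega.

(** * The integrand of variation of constants and its bounds *)

Section Kernel.
Set Implicit Arguments.
Unset Strict Implicit.
Variables (R : realType) (n : nat) (alpha beta : 'I_n -> R).
Local Notation mu := (@lebesgue_measure R).
Local Notation nu := (lebesgue_Omega alpha beta).
Local Notation Om := (Omega alpha beta).
Local Notation H := (L2 nu).
Local Notation dot := (dot_Omega alpha beta).
Local Notation hn := (hnorm dot).
Local Notation cmeas := (@cmeasurable _ (measurableTypeR R) R).
Implicit Types (f g : R -> R[i]) (u v : H) (l : R[i]).

Lemma Omega_bounded : exists2 M : R, 0 <= M & forall x, Om x -> `|x| <= M.
Proof.
exists (\sum_i (`|alpha i| + `|beta i|)).
  by apply: sumr_ge0 => i _; rewrite addr_ge0.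
move=> x [i _]; rewrite /J /= in_itv /= => /andP[ax xb].
rewrite (bigD1 i) //= -[leLHS]addr0; apply: lerD; last first.
  by apply: sumr_ge0 => j _; rewrite addr_ge0.
have := ler_norm (- alpha i); have := ler_norm (beta i).
have := normr_ge0 (alpha i); have := normr_ge0 (beta i).
by rewrite normrN ler_norml; lra.
Qed.

Lemma lebesgue_Omega_lty : (nu [set: R] < +oo)%E.
Proof.
have mO : measurable (Om : set (measurableTypeR R)) := measurable_Omega alpha beta.
have [M M0 OM] := Omega_bounded.
rewrite -[X in (X < _)%E]/(mu ([set: R] `&` Om)) setTI.
apply: (@le_lt_trans _ _ (mu `[- M, M]%classic)).
  apply: le_measure; rewrite ?inE //; last by move=> x /OM;
    rewrite /= in_itv /= ler_norml.
by rewrite lebesgue_measure_itv /=; case: ifP => _; rewrite ltry.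
Qed.

(** The norm of the constant function 1 in L^2(Omega). *)
Definition width : R := Num.sqrt (fine (nu [set: R])).

Lemma cmeasurableM f g : cmeas f -> cmeas g -> cmeas (fun x => f x * g x).
Proof.
move=> [rf jf] [rg jg]; split.
- by under eq_fun do rewrite ReM; apply: measurable_funB; exact: measurable_funM.
- by under eq_fun do rewrite ImM; apply: measurable_funD; exact: measurable_funM.
Qed.

Lemma cmeasurableD f g : cmeas f -> cmeas g -> cmeas (fun x => f x + g x).
Proof.
move=> [rf jf] [rg jg]; split.
- by under eq_fun do rewrite ReD; exact: measurable_funD.
- by under eq_fun do rewrite ImD; exact: measurable_funD.
Qed.

Lemma cmeasurable_conj f : cmeas f -> cmeas (fun x => conjc (f x)).
Proof.
move=> [rf jf]; split.
- by under eq_fun do rewrite ReJ.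
- by under eq_fun do rewrite ImJ; exact: measurable_funN.
Qed.

Lemma cmeasurable_real (h : R -> R) : measurable_fun [set: measurableTypeR R] h ->
  cmeas (fun x => (h x)%:C).
Proof. by move=> mh; split => //=; exact: measurable_cst. Qed.

Lemma cmeasurable_cst (z : R[i]) : cmeas (fun=> z).
Proof. by split; exact: measurable_cst. Qed.

Lemma cmeasurable_cexpl l : cmeas (cexpl l).
Proof.
have [c1 c2] := cder_continuous (cder_cexpl l).
by split; apply: continuous_measurable_fun.
Qed.

Lemma square_integrable_bounded f (C : R) : cmeas f ->
  (forall x, Om x -> normc (f x) <= C) -> square_integrable nu f.
Proof.
move=> mf fC; split=> //.
have mO : measurable (Om : set (measurableTypeR R)) := measurable_Omega alpha beta.
have mf2 := measurable_sqr_normc mf.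
rewrite integral_lebesgue_Omega; last exact/measurable_EFinP.
apply: (@le_lt_trans _ _ (\int[mu]_(x in Om) (C ^+ 2)%:E)%E).
  apply: ge0_le_integral => //.
  - by move=> x _; rewrite lee_fin sqr_ge0.
  - by apply: measurable_funTS; exact/measurable_EFinP.
  - move=> x Ox; rewrite lee_fin ler_pXn2r ?nnegrE ?normc_ge0 //; first exact: fC.
    exact: le_trans (normc_ge0 _) (fC _ Ox).
have := lebesgue_Omega_lty.
rewrite integral_cst // -[X in (X < _)%E -> _]/(mu ([set: R] `&` Om)) setTI => h.
by apply: lte_mul_pinfty => //; rewrite lee_fin sqr_ge0.
Qed.

Lemma hnorm_bounded u f (C : R) : 0 <= C -> cmeas f ->
  (forall x, Om x -> normc (f x) <= C) -> represents u f -> hn u <= C * width.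
Proof.
move=> C0 mf fC uf.
have mO : measurable (Om : set (measurableTypeR R)) := measurable_Omega alpha beta.
have mf2 := measurable_sqr_normc mf.
have Onum : mu Om \is a fin_num.
  have := lebesgue_Omega_lty.
  by rewrite -[X in (X < _)%E -> _]/(mu ([set: R] `&` Om)) setTI ge0_fin_numE.
rewrite -(@ler_pXn2r _ 2) ?nnegrE ?hnorm_ge0 ?mulr_ge0 ?sqrtr_ge0 //.
rewrite sqr_hnorm /rdot [dot u u](l2dot_represents mf mf uf uf) /= exprMn
  sqr_sqrtr; last first.
  by rewrite fine_ge0.
rewrite (@eq_Rintegral _ _ _ nu setT (fun x => normc (f x) ^+ 2)); last first.
  by move=> x _; rewrite ReM ReJ ImJ sqr_normcE; ring.
have -> : nu [set: R] = mu Om.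
  by rewrite -[LHS]/(mu ([set: R] `&` Om)) setTI.
rewrite /Rintegral integral_lebesgue_Omega; last exact/measurable_EFinP.
have <- : fine (\int[mu]_(x in Om) (C ^+ 2)%:E)%E = C ^+ 2 * fine (mu Om).
  exact: Rintegral_cst.
apply: fine_le.
- rewrite ge0_fin_numE; last by apply: integral_ge0 => x _; rewrite lee_fin sqr_ge0.
  rewrite -integral_lebesgue_Omega; last exact/measurable_EFinP.
  by have [_] := square_integrable_bounded mf fC.
- by rewrite integral_cst // fin_numM.
apply: ge0_le_integral => //.
- by move=> x _; rewrite lee_fin sqr_ge0.
- by apply: measurable_funTS; exact/measurable_EFinP.
- move=> x Ox; rewrite lee_fin ler_pXn2r ?nnegrE ?normc_ge0 //; exact: fC.
Qed.

(** Both signs occur in a solution: l in the factor outside the integral, - l under it. *)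
Lemma cexpl_bounded l : exists2 C : R, 1 <= C &
  forall x, Om x -> normc (cexpl l x) <= C /\ normc (cexpl (- l) x) <= C.
Proof.
have [M M0 OM] := Omega_bounded.
set q := `|2 * pi * Im l|; exists (expR (q * M)).
  by rewrite -[leLHS]expR0 ler_expR; apply: mulr_ge0 => //; exact: normr_ge0.
have E (k : R[i]) (x : R) : `|2 * pi * Im k| = q -> Om x ->
    normc (cexpl k x) <= expR (q * M).
  move=> kq Ox; rewrite normc_cexp ler_expR; apply: le_trans (ler_norm _) _.
  have -> : Re (two_pi_i R * (k * x%:C)) = - (2 * pi * Im k * x).
    by rewrite !(ReM, ImM) /=; ring.
  by rewrite normrN normrM kq; apply: ler_wpM2l; [exact: normr_ge0 | exact: OM].
move=> x Ox; split; apply: E => //.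
by rewrite Im_opp mulrN normrN.
Qed.

(** The cut-off makes the integrand integrable over the line, whatever [g] does outside Omega. *)
Definition kern l g y : R[i] := cexpl (- l) y * g y * (\1_Om y)%:C.

(** The conjugate undoes the conjugation in the second argument of the inner product, so that
    pairing with this weight integrates [kern] over [D]. *)
Definition kern_weight l (D : set R) y : R[i] :=
  (\1_D y)%:C * conjc (cexpl (- l) y).

Lemma kernE l g y : kern l g y = if y \in Om then cexpl (- l) y * g y else 0.
Proof.
by rewrite /kern indicE; case: (y \in Om); [exact: mulr1 | exact: mulr0].
Qed.

Lemma kern_weightE l D y :
  kern_weight l D y = if y \in D then conjc (cexpl (- l) y) else 0.
Proof.
by rewrite /kern_weight indicE; case: (y \in D); [exact: mul1r | exact: mul0r].
Qed.

Lemma cmeasurable_kern_weight l (D : set (measurableTypeR R)) : measurable D ->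
  cmeas (kern_weight l D).
Proof.
move=> mD; apply: cmeasurableM.
  by apply: cmeasurable_real; exact: measurable_indic.
exact: cmeasurable_conj (cmeasurable_cexpl _).
Qed.

Lemma normc_kern_weight l (D : set R) y :
  normc (kern_weight l D y) <= normc (cexpl (- l) y).
Proof.
rewrite kern_weightE; case: ifP => _; rewrite !normcE ?(ReJ, ImJ) ?sqrrN //.
by rewrite expr0n addr0 sqrtr0 sqrtr_ge0.
Qed.

Lemma square_integrable_kern_weight l (D : set (measurableTypeR R)) :
  measurable D -> square_integrable nu (kern_weight l D).
Proof.
move=> mD; have [C C1 eC] := cexpl_bounded l.
apply: (@square_integrable_bounded _ C); first exact: cmeasurable_kern_weight.
by move=> x /eC [_ h]; exact: le_trans (normc_kern_weight _ _ _) h.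
Qed.

Definition cint (D : set R) (k : R -> R[i]) : R[i] :=
  (\int[mu]_(t in D) Re (k t)) +i* (\int[mu]_(t in D) Im (k t)).

Lemma cint_eq0 (D : set R) (k : R -> R[i]) :
  (forall x, x \in D -> k x = 0) -> cint D k = 0.
Proof.
move=> k0; rewrite /cint.
rewrite (@eq_Rintegral _ _ _ mu D (cst 0) (fun t => Re (k t)));
  last by move=> x /k0 ->.
rewrite (@eq_Rintegral _ _ _ mu D (cst 0) (fun t => Im (k t)));
  last by move=> x /k0 ->.
by rewrite /Rintegral integral0.
Qed.

Lemma kern_integrable l g : square_integrable nu g -> cintegrable (kern l g).
Proof.
move=> sg; have := square_integrable_kern_weight l (D := setT) measurableT.
move=> /(integrable_mulJ sg) [ir ij].
have := integrable_lebesgue_Omega ir; have := integrable_lebesgue_Omega ij.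
have kE x : g x * conjc (kern_weight l [set: R] x) = cexpl (- l) x * g x.
  by rewrite kern_weightE in_setT conjcK mulrC.
move=> h2 h1; split; [move: h1 | move: h2]; congr (_.-integrable _ _);
  apply/funext => x; rewrite /comp kE kernE indicE.
- by case: (x \in Om); rewrite ?mulr1 ?mulr0.
- by case: (x \in Om); rewrite ?mulr1 ?mulr0.
Qed.

(** As an inner product, the integral can be bounded by Cauchy-Schwarz, and orthogonality of classes
    can make it vanish. *)
Lemma cint_kern (D : set (measurableTypeR R)) l g u v : measurable D ->
  square_integrable nu g -> represents u g -> represents v (kern_weight l D) ->
  cint D (kern l g) = dot u v.
Proof.
move=> mD sg ug vw; have [mg _] := sg.
have mw := cmeasurable_kern_weight l mD.
have mO : measurable (Om : set (measurableTypeR R)) := measurable_Omega alpha beta.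
have me := cmeasurable_cexpl (- l).
have [mr mi] := cmeasurableM mg (cmeasurable_conj mw).
have real_part (F : R[i] -> R) (zero : F 0 = 0) :
    measurable_fun [set: measurableTypeR R] (fun x =>
      F (g x * conjc (kern_weight l D x))) ->
    \int[mu]_(t in D) F (kern l g t) =
    \int[nu]_x F (g x * conjc (kern_weight l D x)).
  move=> mF; rewrite /Rintegral integral_lebesgue_Omega; last exact/measurable_EFinP.
  rewrite -!/(Rintegral _ _ _) Rintegral_mkcond [RHS]Rintegral_mkcond.
  apply: eq_Rintegral => x _; rewrite !patchE kernE kern_weightE.
  case: (x \in D); case: (x \in Om); rewrite ?conjcK ?conjc0 ?mulr0 ?zero //.
  by rewrite mulrC.
rewrite [RHS](l2dot_represents mg mw ug vw) /cint.
by rewrite (real_part (@Re R)) // (real_part (@Im R)).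
Qed.

(** The factor 2 comes from bounding the real and imaginary parts separately, the latter after
    replacing u by i u. *)
Lemma normc_dot_le u v : normc (dot u v) <= 2 * (hn u * hn v).
Proof.
have h (w : H) : `|rdot dot w v| <= hn w * hn v.
  rewrite ler_norml rdot_le andbT lerNl -rdotNl.
  apply: le_trans (rdot_le _ _ _) _.
  by rewrite /hnorm -!/(rdot _ _ _) rdotNl rdotNr opprK.
have iu : hn ('i *: u) = hn u.
  rewrite /hnorm dotZl dotZr mulrA (_ : 'i * conjc 'i = 1 :> R[i]) ?mul1r //.
  by apply: complex_ext; rewrite !(ReM, ImM) /=; ring.
have e : rdot dot ('i *: u) v = - Im (dot u v).
  by rewrite /rdot dotZl ReM; move: (dot u v) => z /=; rewrite mul0r mul1r sub0r.
have h1 := h u; have h2 := h ('i *: u).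
rewrite iu e normrN in h2; rewrite /rdot in h1.
apply: le_trans (normc_le_ReIm _) _; move: h1 h2; move: (dot u v) => z h1 h2.
by rewrite mulrDl mul1r lerD.
Qed.

Lemma normc_cint_kern (D : set (measurableTypeR R)) l g u (C : R) :
  measurable D -> square_integrable nu g -> represents u g -> 0 <= C ->
  (forall x, Om x -> normc (cexpl (- l) x) <= C) ->
  normc (cint D (kern l g)) <= 2 * C * width * hn u.
Proof.
move=> mD sg ug C0 eC.
have [v vw] := L2_class (square_integrable_kern_weight l mD).
rewrite (cint_kern mD sg ug vw); apply: le_trans (normc_dot_le _ _) _.
rewrite -!mulrA ler_pM2l // mulrC mulrA ler_wpM2r ?hnorm_ge0 //.
apply: (hnorm_bounded C0 (cmeasurable_kern_weight l mD) _ vw) => x Ox.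
exact: le_trans (normc_kern_weight _ _ _) (eC _ Ox).
Qed.

End Kernel.

(** * The equation (A - l) w = u *)

Section Solution.
Set Implicit Arguments.
Unset Strict Implicit.
Variables (R : realType) (n : nat) (alpha beta : 'I_n -> R).
Hypothesis alpha_lt_beta : forall i : 'I_n, alpha i < beta i.
Hypothesis beta_lt_alpha : forall i j : 'I_n, (i < j)%N -> beta i < alpha j.
Local Notation mu := (@lebesgue_measure R).
Local Notation nu := (lebesgue_Omega alpha beta).
Local Notation Om := (Omega alpha beta).
Local Notation Ji := (J alpha beta).
Local Notation H := (L2 nu).
Local Notation dot := (dot_Omega alpha beta).
Local Notation hn := (hnorm dot).
Local Notation cmeas := (@cmeasurable _ (measurableTypeR R) R).
Local Notation kern := (kern alpha beta).
Local Notation tpi := (two_pi_i R).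
Implicit Types (f g : R -> R[i]) (u v w : H) (l : R[i]) (c : 'cV[R[i]]_n).

Lemma J_inj i j (x : R) : Ji i x -> Ji j x -> i = j.
Proof.
rewrite /J /= !in_itv /= => /andP[ai ib] /andP[aj jb].
apply: val_inj; case: (ltngtP i j) => // ij.
- by have := lt_trans (lt_trans ib (beta_lt_alpha ij)) aj; rewrite ltxx.
- by have := lt_trans (lt_trans jb (beta_lt_alpha ij)) ai; rewrite ltxx.
Qed.

Lemma J_Omega i (x : R) : Ji i x -> Om x. Proof. by exists i. Qed.

Lemma sum_J (F : 'I_n -> R[i]) i (x : R) : Ji i x ->
  \sum_j F j * (\1_(Ji j) x)%:C = F i.
Proof.
move=> Jx; rewrite (bigD1 i) //= big1 => [|j ji].
  by rewrite addr0 indicE mem_set // [LHS]mulr1.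
rewrite indicE memNset ?[LHS]mulr0 // => Jj.
by move: ji; rewrite (J_inj Jx Jj) eqxx.
Qed.

Definition increment l g (a x : R) : R[i] := prim (kern l g) x - prim (kern l g) a.

(* The solution of [f' / (2 pi i) - l f = g] on Omega with
   [f(alpha_i) = e^{2 pi i l alpha_i} c_i]. *)
Definition solution l c g (x : R) : R[i] := cexpl l x *
  \sum_i (c i 0 + tpi * increment l g (alpha i) x) * (\1_(Ji i) x)%:C.

Lemma solution_J l c g i x : Ji i x ->
  solution l c g x = cexpl l x * (c i 0 + tpi * increment l g (alpha i) x).
Proof. by move=> Jx; rewrite /solution (sum_J _ Jx). Qed.

Lemma increment_cint l g (a x : R) : square_integrable nu g -> a <= x ->
  increment l g a x = cint `]a, x]%classic (kern l g).
Proof.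
move=> sg ax; have [ir ij] := kern_integrable l sg.
by apply: complex_ext; rewrite ?ReD ?ImD ?Re_opp ?Im_opp /= Rintegral_itvNyB.
Qed.

Lemma normc_increment l g u (C a x : R) : square_integrable nu g ->
  represents u g -> 0 <= C -> (forall x, Om x -> normc (cexpl (- l) x) <= C) ->
  a <= x -> normc (increment l g a x) <= 2 * C * width alpha beta * hn u.
Proof.
move=> sg ug C0 eC ax; rewrite increment_cint //.
by apply: normc_cint_kern ug C0 eC => //; exact: measurable_itv.
Qed.

Lemma prim_continuous (k : R -> R[i]) : cintegrable k ->
  ccontinuous (prim k).
Proof.
have cts (h : R -> R) : mu.-integrable [set: R] (EFin \o h) ->
    continuous (fun x : R => \int[mu]_(t in `]-oo, x]) h t).
  move=> ih x; apply/cvgrPdist_lt => e e0.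
  have [d [d0 dP]] := integral_normr_continuous ih e0.
  have key (y z : R) : y <= z -> z - y < d ->
      `|\int[mu]_(t in `]-oo, z]) h t - \int[mu]_(t in `]-oo, y]) h t| < e.
    move=> yz zyd; rewrite Rintegral_itvNyB //.
    apply: le_lt_trans (le_normr_Rintegral _ _) _ => //.
      exact: integrableS ih.
    apply: dP => //; rewrite [ltLHS]lebesgue_measure_itv /= lte_fin.
    by case: ifP => _; rewrite ?lte_fin // -EFinB lte_fin.
  apply/nbhs_ballP; exists d => //= y; rewrite /ball /= => xyd.
  have [xy|/ltW yx] := leP x y.
    rewrite distrC; apply: key => //.
    by move: xyd; rewrite distrC ger0_norm // subr_ge0.
  by apply: key => //; move: xyd; rewrite ger0_norm // subr_ge0.
by move=> [ir ij]; split; exact: cts.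
Qed.

Lemma cmeasurable_sum m (F : 'I_m -> R -> R[i]) : (forall i, cmeas (F i)) ->
  cmeas (fun x => \sum_i F i x).
Proof.
move=> mF; elim: m F mF => [|m ih] F mF.
  by under eq_fun do rewrite big_ord0; exact: cmeasurable_cst.
under eq_fun do rewrite big_ord_recr /=.
by apply: cmeasurableD => //; exact: (ih (fun i => F (widen_ord (leqnSn m) i))).
Qed.

Lemma cmeasurable_solution l c g : square_integrable nu g ->
  cmeas (solution l c g).
Proof.
move=> sg; apply: cmeasurableM; first exact: cmeasurable_cexpl.
apply: cmeasurable_sum => i; apply: cmeasurableM; last first.
  apply: cmeasurable_real; apply: measurable_indic; exact: measurable_itv.
apply: cmeasurableD; first exact: cmeasurable_cst.
apply: cmeasurableM; first exact: cmeasurable_cst.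
apply: cmeasurableD; last exact: cmeasurable_cst.
have [c1 c2] := prim_continuous (kern_integrable l sg).
by split; exact: continuous_measurable_fun.
Qed.

Lemma normc_solution l c g u (C D x : R) : square_integrable nu g ->
  represents u g -> 0 <= C ->
  (forall x, Om x -> normc (cexpl l x) <= C /\ normc (cexpl (- l) x) <= C) ->
  (forall i, normc (c i 0) <= D) -> Om x ->
  normc (solution l c g x) <=
    C * (D + normc tpi * (2 * C * width alpha beta * hn u)).
Proof.
move=> sg ug C0 eC cD [i _ Jx]; rewrite (solution_J _ _ _ Jx) normcM.
have [h1 _] := eC _ (J_Omega Jx); have eC' y Oy := (eC y Oy).2.
apply: ler_pM => //; try exact: normc_ge0.
apply: le_trans (normc_leD _ _) _; apply: lerD => //.
rewrite normcM ler_wpM2l ?normc_ge0 //; apply: normc_increment => //.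
by move: Jx; rewrite /J /= in_itv /= => /andP[/ltW].
Qed.

(** The mean value theorem is applied to the real and to the imaginary part, whence the factor 2. *)
Lemma cexpl_lipschitz l i (C x y : R) :
  (forall x, Om x -> normc (cexpl l x) <= C) ->
  alpha i < x -> x <= y -> y < beta i ->
  normc (cexpl l y - cexpl l x) <= 2 * (normc (tpi * l) * C) * (y - x).
Proof.
move=> eC ax xy yb.
have Lip (F : R[i] -> R) (FP : forall z, `|F z| <= normc z) :
    (forall t : R, is_derive t 1 (fun s =>
      F (cexpl l s)) (F (tpi * l * cexpl l t))) ->
    `|F (cexpl l y) - F (cexpl l x)| <= normc (tpi * l) * C * (y - x).
  move=> DF; have cts : {within `[x, y], continuous (fun s => F (cexpl l s))}.
    apply: continuous_subspaceT => z; have dz := DF z.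
    exact/differentiable_continuous/derivable1_diffP/ex_derive.
  have [z] := MVT_segment xy (fun t _ => DF t) cts.
  rewrite in_itv /= => /andP[xz zy] ->;
    rewrite normrM (ger0_norm (_ : 0 <= y - x)) ?subr_ge0 //.
  rewrite ler_wpM2r ?subr_ge0 //; apply: le_trans (FP _) _; rewrite normcM.
  rewrite ler_wpM2l ?normc_ge0 //; apply: eC; exists i => //.
  by rewrite /J /= in_itv /=; apply/andP; split;
    [exact: lt_le_trans xz | exact: le_lt_trans yb].
apply: le_trans (normc_le_ReIm _) _;
  rewrite ReD ImD Re_opp Im_opp -mulrA mulrDl mul1r.
apply: lerD.
- by apply: (Lip (@Re R)) => [z|t]; [exact: abs_Re_le | have [] := cder_cexpl l t].
- by apply: (Lip (@Im R)) => [z|t]; [exact: abs_Im_le | have [] := cder_cexpl l t].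
Qed.

(** A discrete product rule splits the increment of the solution: the change of the primitive is
    bounded by an integral, that of the exponential by a Lipschitz term times the bound [M] on the
    other factor. *)
Lemma solution_dominated l c g i : square_integrable nu g ->
  dominated (solution l c g) (alpha i) (beta i).
Proof.
move=> sg; have [u ug] := L2_class sg; have ik := kern_integrable l sg.
have [C C1 eC] := cexpl_bounded alpha beta l.
have C0 : 0 <= C := le_trans ler01 C1.
pose M := normc (c i 0) + normc tpi * (2 * C * width alpha beta * hn u).
have M0 : 0 <= M.
  rewrite addr_ge0 ?normc_ge0 // mulr_ge0 ?normc_ge0 //.
  by rewrite !mulr_ge0 // ?sqrtr_ge0 ?hnorm_ge0.
exists (fun t => C * normc tpi * density (kern l g) t).
exists (2 * (normc (tpi * l) * C) * M); split.
- exact: (integrableZl measurableT (C * normc tpi) (integrable_density ik)).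
- by rewrite !mulr_ge0 ?normc_ge0.
move=> x y ax xy yb.
have Jx : Ji i x by rewrite /J /= in_itv /= ax (le_lt_trans xy yb).
have Jy : Ji i y by rewrite /J /= in_itv /= yb (lt_le_trans ax xy).
rewrite (solution_J _ _ _ Jx) (solution_J _ _ _ Jy).
set p := increment _ _ _ y; set q := increment _ _ _ x.
have -> : cexpl l y * (c i 0 + tpi * p) - cexpl l x * (c i 0 + tpi * q) =
    cexpl l y * tpi * (p - q) + (cexpl l y - cexpl l x) * (c i 0 + tpi * q) by ring.
apply: le_trans (normc_leD _ _) _; apply: lerD.
  rewrite [X in X <= _]normcM [X in X * _ <= _]normcM.
  have -> : \int[mu]_(t in `]x, y]) `|C * normc tpi * density (kern l g) t| =
      C * normc tpi * \int[mu]_(t in `]x, y]) density (kern l g) t.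
    rewrite -RintegralZl //; last exact: integrableS (integrable_density ik).
    apply: eq_Rintegral => t _; rewrite ger0_norm //.
    by rewrite !mulr_ge0 ?normc_ge0 ?density_ge0.
  have := eC _ (J_Omega Jy) => -[h _].
  apply: ler_pM; rewrite ?mulr_ge0 ?normc_ge0 //.
    by rewrite ler_wpM2r ?normc_ge0.
  have -> : p - q = prim (kern l g) y - prim (kern l g) x.
    by rewrite /p /q /increment opprB addrA subrK.
  exact: prim_incr.
rewrite [X in X <= _]normcM mulrAC; apply: ler_pM; rewrite ?normc_ge0 //.
  by apply: cexpl_lipschitz ax xy yb => z /eC[].
apply: le_trans (normc_leD _ _) _; apply: lerD => //.
rewrite normcM ler_wpM2l ?normc_ge0 //; apply: normc_increment => //.
- by move=> z /eC[].
- exact: ltW.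
Qed.

Lemma near_J i (x : R) : Ji i x -> \forall t \near x, Ji i t.
Proof. by move=> Jx; exact: near_in_itvoo. Qed.

Lemma solution_cderive l c g : square_integrable nu g ->
  {ae nu, forall x, cderive (solution l c g) x = tpi * (g x + l * solution l c g x)}.
Proof.
move=> sg; have ik := kern_integrable l sg.
have := ae_lebesgue_Omega alpha beta (prim_cder ik).
apply: filterS; first exact: (ae_filter_ringOfSetsType nu).
move=> x [[i _ Jx] dx]; apply: cder_cderive.
have dinc : cder (fun t => c i 0 + tpi * increment l g (alpha i) t) x (tpi *
  kern l g x).
  have := cderD (cder_cst (c i 0) x) (cderM (cder_cst tpi x)
    (cderD dx (cder_cst (- prim (kern l g) (alpha i)) x))).
  by rewrite mul0r addr0 addr0 add0r.
have := cderM (cder_cexpl l x) dinc.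
rewrite (_ : _ + _ = tpi * (g x + l * solution l c g x)); last first.
  rewrite (solution_J _ _ _ Jx) kernE mem_set; last exact: J_Omega Jx.
  (* The exponential of the solution cancels that of the kernel and leaves [g x]. *)
  by rewrite -[g x in RHS]mul1r -(cexplN l x); ring.
apply: cder_near; near=> t; rewrite (@solution_J _ _ _ i) //.
by near: t; exact: near_J.
Unshelve. all: by end_near. Qed.

(** * Boundary values of solutions *)

Lemma solution_cts l c g i : square_integrable nu g ->
  ccontinuous (fun x => cexpl l x * (c i 0 + tpi * increment l g (alpha i) x)).
Proof.
move=> sg; apply: ccontinuousM; first exact: cder_continuous (cder_cexpl l).
apply: ccontinuousD; first exact: ccontinuous_cst.
apply: ccontinuousM; first exact: ccontinuous_cst.
apply: ccontinuousD; last exact: ccontinuous_cst.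
exact: prim_continuous (kern_integrable l sg).
Qed.

(** Each [phi i] is continuous across the endpoints of J_i, so the one-sided limits of [f] are its
    values there. *)
Lemma at_alpha_J f (phi : 'I_n -> R -> R[i]) :
  (forall i x, Ji i x -> f x = phi i x) ->
  (forall i, ccontinuous (phi i)) ->
  at_alpha alpha f = \col_i phi i (alpha i) /\ at_beta beta f = \col_i phi i
    (beta i).
Proof.
move=> fphi cphi.
have key (F : R[i] -> R) (i : 'I_n) : continuous (fun x => F (phi i x)) ->
    lim (F (f x) @[x --> (alpha i)^'+]) = F (phi i (alpha i)) /\
    lim (F (f x) @[x --> (beta i)^'-]) = F (phi i (beta i)).
  move=> cF; split; apply: cvg_lim => //.
  - apply: cvg_trans (cvg_at_right_filter (cF (alpha i))).
    apply: near_eq_cvg; near=> x; rewrite (fphi i) // /J /= in_itv /=.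
    by apply/andP; split; near: x; [exact: nbhs_right_gt | exact: nbhs_right_lt].
  - apply: cvg_trans (cvg_at_left_filter (cF (beta i))).
    apply: near_eq_cvg; near=> x; rewrite (fphi i) // /J /= in_itv /=.
    by apply/andP; split; near: x; [exact: nbhs_left_gt | exact: nbhs_left_lt].
split; apply/matrixP => i j; rewrite !mxE.
- apply: complex_ext => /=.
  + exact: (key (@Re R) i (cphi i).1).1.
  + exact: (key (@Im R) i (cphi i).2).1.
- apply: complex_ext => /=.
  + exact: (key (@Re R) i (cphi i).1).2.
  + exact: (key (@Im R) i (cphi i).2).2.
Unshelve. all: by end_near. Qed.

(** The change of the coefficient c_i across J_i in variation of constants. *)
Definition total l g : 'cV[R[i]]_n :=
  \col_i (tpi * increment l g (alpha i) (beta i)).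

Local Notation Ealpha l := (Emx (fun i => l * (alpha i)%:C)).
Local Notation Ebeta l := (Emx (fun i => l * (beta i)%:C)).

Lemma Emx_col (a : 'I_n -> R) l (c : 'cV[R[i]]_n) :
  Emx (fun i => l * (a i)%:C) *m c = \col_i (cexpl l (a i) * c i 0).
Proof.
by apply/matrixP => i j; rewrite /Emx mul_diag_mx !mxE ord1.
Qed.

Lemma solution_boundary l c g : square_integrable nu g ->
  at_alpha alpha (solution l c g) = Ealpha l *m c /\
  at_beta beta (solution l c g) = Ebeta l *m (c + total l g).
Proof.
move=> sg; rewrite !Emx_col.
have [-> ->] := at_alpha_J (solution_J l c g) (fun i => solution_cts l c i sg).
split; apply/matrixP => i j; rewrite !mxE //.
by rewrite /increment subrr mulr0 addr0.
Qed.

Lemma tpi_neq0 : tpi != 0.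
Proof.
apply/eqP => /(congr1 (@Im R)) /= /eqP; rewrite mulf_eq0 pnatr_eq0 /=.
by rewrite gt_eqF // pi_gt0.
Qed.

(** [solution l c g] is absolutely continuous and satisfies the equation almost everywhere; only the
    boundary condition remains, and by [solution_boundary] it is the linear system assumed for c. *)
Lemma solution_domain (B : 'M[R[i]]_n) l c g u : square_integrable nu g ->
  represents u g -> B *m (Ealpha l *m c) = Ebeta l *m (c + total l g) ->
  exists2 w : H, represents w (solution l c g) & D_boundary B (w, u + l *: w).
Proof.
move=> sg ug Bc; have [ha hb] := solution_boundary l c sg.
have [C C1 eC] := cexpl_bounded alpha beta l.
have C0 : 0 <= C := le_trans ler01 C1.
have cD i : normc (c i 0) <= \sum_j normc (c j 0).
  by rewrite (bigD1 i) //= lerDl sumr_ge0 // => j _; exact: normc_ge0.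
have [w wS] := L2_class (square_integrable_bounded (cmeasurable_solution l c sg)
  (fun x => normc_solution sg ug C0 eC cD (x := x))).
have dS : {ae nu, forall x, g x + l * solution l c g x =
    tpi^-1 * cderive (solution l c g) x}.
  have := solution_cderive l c sg.
  apply: filterS; first exact: (ae_filter_ringOfSetsType nu).
  by move=> x ->; rewrite mulKf //; exact: tpi_neq0.
have rS : represents (u + l *: w) (fun x => tpi^-1 * cderive (solution l c g) x).
  apply: represents_ae dS _; rewrite addrC.
  have := represents_lin l wS ug.
  by under eq_fun do rewrite addrC.
exists w => //; exists (solution l c g); split=> //=; last by rewrite ha hb.
split; first by move=> i; apply/dominated_ac/solution_dominated.
exists (tpi *: (u + l *: w)); have := represents_scale tpi rS.
by under eq_fun do rewrite mulVKf ?tpi_neq0 //.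
Qed.

(** * From equality almost everywhere to equality on the intervals *)

Lemma ae_itv (Q : R -> Prop) i (a b : R) : {ae nu, forall x, Q x} ->
  alpha i <= a -> a < b -> b <= beta i -> exists x : R, a < x < b /\ Q x.
Proof.
move=> [N [mN N0 QN]] ia ab bi; apply: contrapT => nex.
have abN : (`]a, b[ `<=` N `&` Om)%classic.
  move=> x; rewrite /= in_itv /= => /andP[ax xb]; split.
    by apply: QN => Qx; apply: nex; exists x; rewrite ax xb.
  exists i => //; rewrite /J /= in_itv /=.
  by rewrite (le_lt_trans ia ax) (lt_le_trans xb bi).
have mO : measurable (Om : set (measurableTypeR R)) := measurable_Omega alpha beta.
have : (mu `]a, b[%classic <= 0)%E.
  rewrite -N0 -[leRHS]/(mu (N `&` Om)); apply: le_measure => //; rewrite ?inE //.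
  exact: measurableI.
rewrite [leLHS]lebesgue_measure_itv /= lte_fin ab -EFinB lee_fin subr_le0.
by rewrite leNgt ab.
Qed.

(** If |f x - g x| = e > 0, a point y slightly to the right of x with f y = g y lies within both
    moduli of continuity for e / 2, a contradiction. *)
Lemma ac_ae_eq f g i : absolutely_continuous f (alpha i) (beta i) ->
  absolutely_continuous g (alpha i) (beta i) ->
  {ae nu, forall x, f x = g x} -> forall x, Ji i x -> f x = g x.
Proof.
move=> acf acg fg x Jx; apply/eqP; rewrite -subr_eq0; apply/eqP/eq0_normc.
apply/eqP; rewrite eq_le normc_ge0 andbT leNgt; apply/negP => e0.
set e := normc _ in e0.
have e2 : 0 < e / 2 by rewrite divr_gt0.
have [d1 d10 h1] := absolutely_continuous_dist acf e2.
have [d2 d20 h2] := absolutely_continuous_dist acg e2.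
move: (Jx); rewrite /J /= in_itv /= => /andP[ax xb].
have [y [/andP[xy yb] fgy]] : exists y : R, x < y < Num.min (beta i) (Num.min
  (x + d1) (x + d2)) /\ f y = g y.
  apply: (ae_itv fg (i := i)) => //; first exact: ltW.
    by rewrite !lt_min xb !ltrDl d10 d20.
  by rewrite ge_min lexx.
move: yb; rewrite !lt_min => /and3P[yb yd1 yd2].
have ay : alpha i < y < beta i by rewrite yb (lt_trans ax xy).
have axb : alpha i < x < beta i by rewrite ax.
have xyd (d : R) : y < x + d -> `|x - y| < d.
  by move=> h; rewrite distrC ger0_norm ?subr_ge0 ?(ltW xy) // ltrBlDl.
have k1 := h1 _ _ axb ay (xyd _ yd1); have k2 := h2 _ _ axb ay (xyd _ yd2).
have : e <= normc (f x - f y) + normc (g x - g y).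
  rewrite -(normcN (g x - g y)); apply: le_trans (normc_leD _ _).
  by rewrite opprB fgy addrA subrK.
by rewrite leNgt [ltRHS]splitr ltrD.
Qed.

(** * Eigenfunctions as solutions with right-hand side 0 *)

Lemma increment0 l (a x : R) : increment l (fun=> 0) a x = 0.
Proof.
rewrite /increment; have k0 : kern l (fun=> 0) = fun=> 0.
  by apply/funext => y; rewrite kernE mulr0; case: ifP.
have p0 (t : R) : prim (kern l (fun=> 0)) t = 0.
  by rewrite k0 /prim /=; apply: complex_ext => /=; rewrite /Rintegral integral0.
by rewrite !p0 subrr.
Qed.

Lemma solution0 l c : solution l c (fun=> 0) = eigenfunction alpha beta l c.
Proof.
apply/funext => x; rewrite /solution /eigenfunction; congr (_ * _).
by apply: eq_bigr => i _; rewrite increment0 mulr0 addr0.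
Qed.

Lemma square_integrable_cst0 : square_integrable nu (fun=> 0).
Proof. exact: square_integrable0. Qed.

Lemma total0 l : total l (fun=> 0) = 0.
Proof. by apply/matrixP => i j; rewrite !mxE increment0 mulr0. Qed.

Lemma eigenfunction_J l c i (x : R) : Ji i x ->
  eigenfunction alpha beta l c x = cexpl l x * c i 0.
Proof. by move=> Jx; rewrite -solution0 (solution_J _ _ _ Jx) increment0 mulr0
  addr0. Qed.

Lemma eigenfunction_class l c : exists w : H, represents w (eigenfunction
  alpha beta l c).
Proof.
have sg := square_integrable_cst0.
have [C C1 eC] := cexpl_bounded alpha beta l.
have C0 : 0 <= C := le_trans ler01 C1.
have cD i : normc (c i 0) <= \sum_j normc (c j 0).
  by rewrite (bigD1 i) //= lerDl sumr_ge0 // => j _; exact: normc_ge0.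
rewrite -solution0; apply: L2_class.
exact: (square_integrable_bounded (cmeasurable_solution l c sg)
  (fun x => normc_solution sg (represents0 nu) C0 eC cD (x := x))).
Qed.

Lemma eigenfunction_lin l (a : R[i]) u v c d :
  represents u (eigenfunction alpha beta l c) ->
  represents v (eigenfunction alpha beta l d) ->
  represents (a *: u + v) (eigenfunction alpha beta l (a *: c + d)).
Proof.
move=> uc vd; have := represents_lin a uc vd.
congr represents; apply/funext => x; rewrite /eigenfunction mulrCA -mulrDr.
congr (_ * _); rewrite mulr_sumr -big_split; apply: eq_bigr => i _ /=.
by rewrite !mxE; ring.
Qed.

Lemma eigenfunction0 l : represents (0 : H) (eigenfunction alpha beta l 0).
Proof.
have := represents0 nu; congr represents; apply/funext => x.
rewrite /eigenfunction big1 ?mulr0 // => i _; rewrite mxE; exact: mul0r.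
Qed.

(** Each J_i contains a point where the function vanishes, and the exponential factor never does. *)
Lemma eigenfunction_inj l c : represents (0 : H) (eigenfunction alpha beta l
  c) -> c = 0.
Proof.
move=> c0; apply/matrixP => i j; rewrite (ord1 j) mxE.
have [x [/andP[ax xb] hx]] : exists x : R, alpha i < x < beta i /\
    (fun=> 0) x = eigenfunction alpha beta l c x.
  exact: (ae_itv (represents_ae_eq (represents0 nu) c0) (i := i)).
move: hx; rewrite (@eigenfunction_J _ _ i) /J /= ?in_itv /= ?ax //.
by move/esym/eqP; rewrite mulf_eq0 (negPf (cexpl_neq0 _ _)) => /eqP.
Qed.

(** * Solvability at real l and the dimension of spectral windows *)

Variable B : 'M[R[i]]_n.
Variable A : set (H * H).
Hypothesis A_sa : self_adjoint dot A.
Hypothesis A_B : A = D_boundary B.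

Lemma eigenfunction_eigen l c : B *m Ealpha l *m c = Ebeta l *m c ->
  exists2 w : H, represents w (eigenfunction alpha beta l c) & A (w, l *: w).
Proof.
move=> Bc; have := @solution_domain B l c _ 0 square_integrable_cst0
  (represents0 nu).
rewrite solution0 total0 addr0 mulmxA => /(_ Bc)[w wc Aw]; exists w => //.
by rewrite A_B; move: Aw; rewrite add0r.
Qed.

Lemma represents_itv_weight (l : R) i :
  kern_weight l%:C (Ji i) = eigenfunction alpha beta l%:C (delta_mx i 0).
Proof.
apply/funext => x; rewrite kern_weightE conjc_cexpl_real.
case: ifPn => [/set_mem Jx|nJ].
  by rewrite (eigenfunction_J _ _ Jx) mxE !eqxx mulr1.
rewrite /eigenfunction big1 ?mulr0 // => j _; rewrite mxE eqxx andbT.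
have [->|_] := eqVneq j i; last exact: mul0r.
by rewrite indicE (negPf nJ) [LHS]mulr0.
Qed.

(** For real l the weight of J_i is the function e^{2 pi i l x} on J_i, so the i-th entry is 2 pi i
    <u, e_i>. *)
Lemma total_orth (l : R) (e : 'I_n -> H) g u : square_integrable nu g ->
  represents u g ->
  (forall i, represents (e i) (eigenfunction alpha beta l%:C (delta_mx i 0))) ->
  (forall i, dot u (e i) = 0) -> total l%:C g = 0.
Proof.
move=> sg ug eE ue; apply/matrixP => i j; rewrite !mxE.
rewrite (increment_cint l%:C sg (ltW (alpha_lt_beta i))).
have [ir ij] := kern_integrable l%:C sg.
have -> : cint `]alpha i, beta i]%classic (kern l%:C g) = cint (Ji i) (kern l%:C g).
  by rewrite /cint !Rintegral_itv_bndo_bndc //;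
    [exact: integrableS ij | exact: integrableS ir].
rewrite (cint_kern _ sg ug (v := e i)) ?ue ?mulr0 //; first exact: measurable_itv.
by rewrite represents_itv_weight.
Qed.

(** The constant K of the overview: [normc_solution] with C = 1 and D = 0 bounds the solution
    pointwise, and one more [width] passes to the norm. *)
Definition bound_const : R :=
  normc tpi * (2 * width alpha beta) * width alpha beta.

Lemma bound_const_ge0 : 0 <= bound_const.
Proof. by rewrite !mulr_ge0 ?normc_ge0 ?sqrtr_ge0. Qed.

(* With initial value 0 the solution vanishes at all endpoints, hence satisfies
   every boundary condition; the bound does not depend on [l]. *)
Lemma orth_solution (l : R) (e : 'I_n -> H) u :
  (forall i, represents (e i) (eigenfunction alpha beta l%:C (delta_mx i 0))) ->
  (forall i, dot u (e i) = 0) ->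
  exists2 w, A (w, u + l%:C *: w) & hn w <= bound_const * hn u.
Proof.
move=> eE ue; have su := L2_sqint u.
have uu : represents u u by exact: ae_eq_refl.
have t0 := total_orth su uu eE ue.
have [|w wS Dw] := @solution_domain B l%:C 0 u u su uu.
  by rewrite t0 addr0 !mulmx0.
exists w; first by rewrite A_B.
have eC x : Om x -> normc (cexpl l%:C x) <= 1 /\ normc (cexpl (- l%:C) x) <= 1.
  by move=> _; rewrite -rmorphN !normc_cexpl_real.
have c0 i : normc ((0 : 'cV[R[i]]_n) i 0) <= 0.
  by rewrite mxE normcE expr0n addr0 sqrtr0.
have := hnorm_bounded _ (cmeasurable_solution l%:C 0 su)
  (fun x => normc_solution su uu ler01 eC c0 (x := x)) wS.
rewrite mul1r add0r mulr1 /bound_const => h; apply: le_trans (h _) _.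
  by rewrite !mulr_ge0 ?normc_ge0 ?sqrtr_ge0 ?hnorm_ge0.
by rewrite le_eqVlt; apply/orP; left; apply/eqP; ring.
Qed.

(** An (n + 1) x n matrix of inner products has a nonzero left kernel. *)
Lemma sum_kernel_row (V : lmodType R[i]) (d : {dot V for conjC})
    (x : 'I_n.+1 -> V) (e : 'I_n -> V) :
  exists2 s : 'I_n.+1 -> R[i], exists i, s i != 0 &
    forall j, d (\sum_i s i *: x i) (e j) = 0.
Proof.
pose M : 'M[R[i]]_(n.+1, n) := \matrix_(i, j) d (x i) (e j).
have kM : kermx M != 0.
  by rewrite -mxrank_eq0 mxrank_ker subn_eq0 -ltnNge ltnS rank_leq_col.
have /rowV0Pn[s sM s0] := kM.
exists (fun i => s 0 i).
  apply/existsP; apply: contraNT s0; rewrite negb_exists => /forallP h.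
  by apply/eqP/matrixP => i j; rewrite (ord1 i) mxE; apply/eqP;
    rewrite -[_ == _]negbK.
move=> j; have /matrixP/(_ 0 j) : s *m M = 0 by exact/sub_kermxP.
rewrite !mxE => <-; rewrite linear_sumlz.
apply: eq_bigr => i _.
by rewrite linearZl_LR mxE.
Qed.

(** Chosen so that K times [gap] is at most 1/2; the added 1 keeps the denominator positive. *)
Definition gap : R := (2 * (bound_const + 1))^-1.

Lemma gap_gt0 : 0 < gap.
Proof. by rewrite invr_gt0 mulr_gt0 // ltr_wpDl // bound_const_ge0. Qed.

Lemma gap_bound : bound_const * gap <= 2^-1.
Proof.
have K0 := bound_const_ge0; have K1 : 0 < bound_const + 1 by rewrite ltr_wpDl.
rewrite /gap invfM mulrCA ler_piMr ?invr_ge0 // -ler_pdivlMr ?invr_gt0 //.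
by rewrite div1r invrK lerDl.
Qed.

(* A combination of the [x i] orthogonal to the n functions e^{2 pi i a x} 1_{J_j}
   is (A - a) w with |w| <= K |X|, whereas |(A - a) X| <= gap |X|. *)
Lemma eigenprojection_local_dim (P : pvm dot) (A_P : spectral_measure A P)
    (a : R) (x : 'I_n.+1 -> H) :
  (forall i, P `[a - gap, a + gap]%classic (x i) = x i) ->
  exists2 s : 'I_n.+1 -> R[i], \sum_i s i *: x i = 0 & exists i, s i != 0.
Proof.
move=> Px; have /choice[e eE] := fun i => eigenfunction_class a%:C (delta_mx i 0).
have [s s0 sX] := sum_kernel_row dot x e; exists s => //.
set X := \sum_i _ in sX *; set I : set R := `[a - gap, a + gap]%classic in Px.
have mI : measurable I by exact: measurable_itv.
have PX : P I X = X.
  by rewrite /X linear_sum; apply: eq_bigr => i _; rewrite linearZ /= Px.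
have Ir (t : R) : I t -> `|t - a| <= gap.
  by rewrite /I /= in_itv /= ler_norml => /andP[]; lra.
have IM (t : R) : I t -> `|t| <= `|a| + gap.
  move=> /Ir tr; rewrite -[t](subrK a) addrC; apply: le_trans (ler_normD _ _) _.
  by rewrite lerD2l.
have [X' AX] : domain A X by rewrite -PX; exact: (domain_bounded_proj A_P X mI IM).
have [w Aw wK] := orth_solution eE sX.
(* Symmetry moves A - a from w to X; the two bounds then give |X|^2 <= |X|^2 / 2. *)
have XX : rdot dot X X = rdot dot (X' - a%:C *: X) w.
  rewrite rdotDl rdotNl rdotZl /rdot (sa_sym A_sa AX Aw) -!/(rdot _ _ _).
  by rewrite rdotDr rdotZr addrK.
have h1 := proj_bound A_sa A_P mI (ltW gap_gt0) Ir PX AX.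
have h2 := rdot_le dot (X' - a%:C *: X) w; rewrite -XX -sqr_hnorm in h2.
apply: (@hnorm_eq0 _ _ dot); have q0 := hnorm_ge0 dot X.
have b0 := hnorm_ge0 dot w; have g0 := ltW gap_gt0.
have K0 := bound_const_ge0; have Kg := gap_bound.
move: h1 h2 wK; set q := hnorm dot X in q0 *; set b := hnorm dot w in b0 *.
set p := hnorm _ _ => h1 h2 wK.
have h3 : p * b <= (gap * q) * (bound_const * q).
  by apply: ler_pM => //; exact: hnorm_ge0.
have h4 : (bound_const * gap) * q ^+ 2 <= 2^-1 * q ^+ 2.
  by rewrite ler_wpM2r // sqr_ge0.
have : q ^+ 2 <= 2^-1 * q ^+ 2.
  apply: le_trans h2 _; apply: le_trans h3 _; apply: le_trans h4.
  by rewrite le_eqVlt; apply/orP; left; apply/eqP; ring.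
by move=> h5; apply/eqP; rewrite -sqrf_eq0 eq_le sqr_ge0 andbT; lra.
Qed.

(** * The characteristic matrix and the resolvent *)

Local Notation charmx l := (1%:M - invmx (Ebeta l) *m B *m Ealpha l).

Lemma Emx_unit (a : 'I_n -> R) l : Emx (fun i => l * (a i)%:C) \in unitmx.
Proof.
rewrite unitmxE /Emx det_diag unitfE; apply/prodf_neq0 => i _.
by rewrite mxE; exact: cexpl_neq0.
Qed.

Lemma charmx_kernel l c : charmx l *m c = 0 <-> B *m Ealpha l *m c = Ebeta l *m c.
Proof.
have Eu := Emx_unit beta l; rewrite mulmxBl mul1mx -!mulmxA.
split=> [/eqP|->]; last by rewrite mulKmx // subrr.
by rewrite subr_eq0 => /eqP h; rewrite [in RHS]h mulKVmx.
Qed.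

Lemma det_charmx_eq0 l : \det (charmx l) = 0 -> eigenvalue_of A l.
Proof.
rewrite -det_tr => /eqP/det0P [r r0 rM].
have /charmx_kernel Bc : charmx l *m r^T = 0.
  by rewrite -[LHS]trmxK trmx_mul trmxK rM trmx0.
have [w wE Aw] := eigenfunction_eigen Bc; exists w => //.
apply: contra_neq r0 => w0; move: wE; rewrite w0 => /eigenfunction_inj.
by move=> /(congr1 trmx); rewrite trmxK trmx0.
Qed.

(** The boundary system reads [charmx l *m c = - total l u], solved by inversion. [T] bounds the
    entries of [total l u] relative to |u|, and [N] those of the inverse matrix. *)
Lemma resolvent_solution l : \det (charmx l) != 0 ->
  exists M : R, forall u, exists2 w, A (w, u + l *: w) & hn w <= M * hn u.
Proof.
move=> d0; have Mu : charmx l \in unitmx by rewrite unitmxE unitfE.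
have [C C1 eC] := cexpl_bounded alpha beta l.
have C0 : 0 <= C := le_trans ler01 C1.
pose T := normc tpi * (2 * C * width alpha beta).
have T0 : 0 <= T by rewrite !mulr_ge0 ?normc_ge0 ?sqrtr_ge0.
pose N := \sum_i \sum_j normc (invmx (charmx l) i j).
exists (C * (N * T + T) * width alpha beta) => u.
have su := L2_sqint u; have uu : represents u u by exact: ae_eq_refl.
pose c := - (invmx (charmx l) *m total l u).
have Bc : B *m (Ealpha l *m c) = Ebeta l *m (c + total l u).
  have : charmx l *m c = - total l u by rewrite mulmxN mulKVmx.
  rewrite mulmxBl mul1mx => /eqP; rewrite subr_eq addrC -subr_eq opprK => /eqP ->.
  by rewrite -!mulmxA mulKVmx // Emx_unit.
have [w wS Dw] := solution_domain su uu Bc.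
exists w; first by rewrite A_B.
have tT j : normc (total l u j 0) <= T * hn u.
  rewrite mxE normcM /T -!mulrA ler_wpM2l ?normc_ge0 // !mulrA.
  by apply: normc_increment => // [z /eC[]//|]; exact: ltW.
have cD i : normc (c i 0) <= N * (T * hn u).
  rewrite mxE normcN mxE; apply: le_trans (_ : \sum_j normc (invmx (charmx l)
    i j) * (T * hn u) <= _).
    elim/big_ind2: _ => [|a1 b1 a2 b2 h1 h2|j _].
    - by rewrite normcE expr0n addr0 sqrtr0.
    - by apply: le_trans (normc_leD _ _) _; exact: lerD.
    - by rewrite normcM ler_wpM2l ?normc_ge0.
  rewrite -mulr_suml; apply: ler_wpM2r; first by rewrite mulr_ge0 ?hnorm_ge0.
  rewrite /N [leRHS](bigD1 i) //= lerDl.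
  by apply: sumr_ge0 => j _; apply: sumr_ge0 => k _; exact: normc_ge0.
have N0 : 0 <= N.
  by apply: sumr_ge0 => j _; apply: sumr_ge0 => k _; exact: normc_ge0.
have := hnorm_bounded _ (cmeasurable_solution l c su)
  (fun x => normc_solution su uu C0 eC cD (x := x)) wS.
have -> : C * (N * (T * hn u) + normc tpi * (2 * C * width alpha beta * hn u)) =
    C * (N * T + T) * hn u by rewrite /T; ring.
move=> h; rewrite mulrAC; apply: h.
exact: mulr_ge0 (mulr_ge0 C0 (addr_ge0 (mulr_ge0 N0 T0) T0)) (hnorm_ge0 _ _).
Qed.

Lemma det_charmx_resolvent l : \det (charmx l) != 0 -> resolvent_set dot A l.
Proof.
move=> d0; have [M MP] := resolvent_solution d0.
(* If conj l were singular it would be an eigenvalue, hence real and equal to l. *)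
have d1 : \det (charmx (conjc l)) != 0.
  apply: contra_neq d0 => h; have el := det_charmx_eq0 h.
  suff -> : l = conjc l by [].
  have /(congr1 (@Im R)) := eigenvalue_real A_sa el; rewrite ImJ /= => i0.
  by apply: complex_ext; rewrite ?ReJ ?ImJ // -[LHS]opprK i0 oppr0.
have [M' MP'] := resolvent_solution d1.
(* Solve (A - conj l) w = z; then <z, z> = <(A - l) z, w> = 0. *)
have inj z : A (z, l *: z) -> z = 0.
  move=> Az; have [w Aw _] := MP' z.
  apply: (@rdot_eq0 _ _ dot); rewrite /rdot.
  have := sa_sym A_sa Az Aw; rewrite dotZl dotDr dotZr conjcK.
  by rewrite -[LHS]add0r => /addIr <-.
have /choice[S SP] : forall u, exists w, A (w, u + l *: w) /\ hn w <= M * hn u.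
  by move=> u; have [w ? ?] := MP u; exists w.
have uniq u w : A (w, u + l *: w) -> w = S u.
  move=> Aw; apply/eqP; rewrite -subr_eq0; apply/eqP/inj.
  have := sa_lin A_sa (-1) (SP u).1 Aw.
  rewrite !scaleN1r opprD addrACA addNr add0r addrC [- _ + w]addrC.
  by rewrite scalerBr.
(* [S] comes from a choice of solutions; uniqueness makes it linear. *)
have Slin : linear S.
  move=> a u v; apply/esym/uniq.
  have := sa_lin A_sa a (SP u).1 (SP v).1.
  by rewrite !scalerDr !scalerA addrACA [a * l]mulrC.
pose SL : {linear H -> H} := HB.pack S (GRing.isLinear.Build _ _ _ _ S Slin).
exists SL; split; first by exists M => u; exact: (SP u).2.
move=> u v; split=> [Au|->]; last exact: (SP v).1.
exact: uniq.
Qed.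

(** * Eigenvectors as combinations of exponentials on the intervals *)

Lemma eigenfunction_sum m l (a : 'I_m -> R[i]) (w : 'I_m -> H) (c : 'I_m ->
  'cV[R[i]]_n) :
  (forall i, represents (w i) (eigenfunction alpha beta l (c i))) ->
  represents (\sum_i a i *: w i) (eigenfunction alpha beta l (\sum_i a i *: c i)).
Proof.
move=> wc; apply: (big_rec2 (fun v d =>
  represents v (eigenfunction alpha beta l d))).
  exact: eigenfunction0.
by move=> i d v _ h; exact: eigenfunction_lin.
Qed.

Lemma dot_itv_orth (l : R) (e : 'I_n -> H) :
  (forall i, represents (e i) (eigenfunction alpha beta l%:C (delta_mx i 0))) ->
  forall i j, i != j -> dot (e i) (e j) = 0.
Proof.
move=> eE i j ij; have ei := eE i; have ej := eE j.
rewrite -represents_itv_weight in ei; rewrite -represents_itv_weight in ej.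
have mJ k : measurable (Ji k : set (measurableTypeR R)) by exact: measurable_itv.
have si := square_integrable_kern_weight alpha beta l%:C (mJ i).
rewrite -(cint_kern (mJ j) si ei ej).
have k0 x : x \in Ji j -> kern l%:C (kern_weight l%:C (Ji i)) x = 0.
  move=> /set_mem Jx; rewrite kernE kern_weightE (_ : (x \in Ji i) = false).
    by rewrite mulr0 if_same.
  by apply: memNset => Jx'; move: ij; rewrite (J_inj Jx Jx') eqxx.
exact: cint_eq0.
Qed.

(** Let p be the orthogonal projection of z onto the span of the [e i]. Then g = z - p is (A - l) w
    for some w, so <z, g> = 0; also <p, g> = 0, hence g = 0. *)
Lemma eigenvector_eigenfunction (l : R) z : A (z, l%:C *: z) ->
  exists2 c, B *m Ealpha l%:C *m c = Ebeta l%:C *m c &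
    represents z (eigenfunction alpha beta l%:C c).
Proof.
move=> Az; have /choice[e eE] := fun i => eigenfunction_class l%:C (delta_mx i 0).
have e0 i : dot (e i) (e i) != 0.
  rewrite dnorm_eq0; apply/eqP => ei0; have := eE i; rewrite ei0.
  move=> /eigenfunction_inj /matrixP/(_ i 0) /eqP.
  by rewrite !mxE !eqxx oner_eq0.
pose a i := dot z (e i) / dot (e i) (e i); pose p := \sum_i a i *: e i.
pose g := z - p.
have dot_sum x (b : 'I_n -> R[i]) : dot (\sum_i b i *: e i) x = \sum_i b i *
  dot (e i) x.
  by rewrite linear_sumlz; apply: eq_bigr => i _; rewrite linearZl_LR.
have gE j : dot g (e j) = 0.
  rewrite /g dotDl dotNl dot_sum (bigD1 j) //= big1 => [|i ij].
    by rewrite addr0 divfK // subrr.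
  by rewrite (dot_itv_orth eE ij) mulr0.
have [w Aw _] := orth_solution eE gE.
have zg : dot z g = 0.
  have := sa_sym A_sa Az Aw; rewrite dotZl dotDr dotZr.
  rewrite (_ : conjc l%:C = l%:C); last by apply: complex_ext => //;
    rewrite ImJ oppr0.
  by rewrite -[LHS]add0r => /addIr <-.
have zp : z = p.
  apply/eqP; rewrite -subr_eq0 -(dnorm_eq0 dot) -/g {1}/g dotDl dotNl zg dot_sum.
  by rewrite big1 ?subr0 // => i _; rewrite dotC gE conjc0 mulr0.
pose c := \sum_i a i *: (delta_mx i 0 : 'cV[R[i]]_n).
have zc : represents z (eigenfunction alpha beta l%:C c).
  by rewrite zp; exact: eigenfunction_sum.
(* The domain supplies a representative [f] that meets the boundary condition; by [ac_ae_eq] it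
   equals the eigenfunction on every J_i, which transfers the condition to [c]. *)
exists c => //; have : domain A z by exists (l%:C *: z).
rewrite A_B => -[v [f [[acf _] Bf zf _]]].
have fJ i x : Ji i x -> f x = cexpl l%:C x * c i 0.
  move=> Jx; rewrite -(eigenfunction_J _ _ Jx).
  apply: (ac_ae_eq (acf i) _ (represents_ae_eq zf zc) Jx).
  by rewrite -solution0; exact: (dominated_ac (solution_dominated _ _ _
    square_integrable_cst0)).
have [|fa fb] := at_alpha_J fJ.
  by move=> i; apply: ccontinuousM;
    [exact: cder_continuous (cder_cexpl _) | exact: ccontinuous_cst].
by rewrite -mulmxA !Emx_col -fa -fb.
Qed.

(** * Unboundedness of the operator and dimension of its eigenspaces *)

(** A step at the midpoint m of an interval: a representative [f] takes the values 1 and 0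
    arbitrarily close to m, against uniform continuity. *)
Lemma domain_neqT : (0 < n)%N -> exists u : H, ~ domain A u.
Proof.
move=> n0; pose i := Ordinal n0; pose m := (alpha i + beta i) / 2.
have am : alpha i < m by rewrite /m ltr_pdivlMr //; have := alpha_lt_beta i; lra.
have mb : m < beta i by rewrite /m ltr_pdivrMr //; have := alpha_lt_beta i; lra.
pose s (x : R) : R[i] := (\1_(`]-oo, m]%classic : set R) x)%:C.
have ms : cmeas s.
  by apply: cmeasurable_real; apply: measurable_indic; exact: measurable_itv.
have s1 x : normc (s x) <= 1.
  rewrite normcE /s /= indicE expr0n addr0; case: (x \in _).
    by rewrite expr1n sqrtr1.
  by rewrite expr0n sqrtr0.
have [u us] := L2_class (square_integrable_bounded ms (fun x (_ : Om x) => s1 x)).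
exists u; rewrite A_B => -[v [f [[acf _] _ uf _]]].
have [d d0 dP] := absolutely_continuous_dist (acf i) ltr01.
have fs := represents_ae_eq uf us.
(* Staying within d / 2 of m on each side keeps the two points closer than d. *)
have [|||x [/andP[x1 x2] fx]] := @ae_itv _ i (Num.max (alpha i) (m - d / 2)) m fs.
- by rewrite le_max lexx.
- by rewrite gt_max am ltrBlDr ltrDl divr_gt0.
- exact: ltW.
have [|||y [/andP[y1 y2] fy]] := @ae_itv _ i m (Num.min (beta i) (m + d / 2)) fs.
- exact: ltW.
- by rewrite lt_min mb ltrDl divr_gt0.
- by rewrite ge_min lexx.
move: x1 y2; rewrite gt_max lt_min => /andP[ax xd] /andP[yb yd].
have := dP x y; rewrite ax yb (lt_trans x2 mb) (lt_trans am y1).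
have xyd : `|x - y| < d.
  rewrite distrC ger0_norm; last by rewrite subr_ge0 ltW // (lt_trans x2).
  by lra.
move=> /(_ erefl erefl xyd); rewrite fx fy /s !indicE.
rewrite mem_set /=; last by rewrite in_itv /= ltW.
rewrite memNset /=; last by rewrite in_itv /=; apply/negP; rewrite -ltNge.
by rewrite !subr0 expr1n expr0n addr0 sqrtr1 ltxx.
Qed.

(** The map from c to its eigenfunction is linear and injective, so a basis of the solutions c is
    carried to a basis of V. [kermx] acts on row vectors, hence the transposes. *)
Lemma eigenspace_dim (l : R) (V : set H) :
  V = [set u : H | exists2 c : 'cV[R[i]]_n, B *m Ealpha l%:C *m c = Ebeta l%:C *m c &
         represents u (eigenfunction alpha beta l%:C c)] ->
  exists2 k : nat, (k <= n)%N & has_dimension V k.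
Proof.
move=> ->; pose N := (B *m Ealpha l%:C - Ebeta l%:C)^T.
have kerP c : B *m Ealpha l%:C *m c = Ebeta l%:C *m c <-> (c^T <= kermx N)%MS.
  rewrite sub_kermx -trmx_mul mulmxBl -[X in _ == X]trmx0 (inj_eq trmx_inj).
  by rewrite subr_eq0; split=> [->|/eqP].
exists (\rank (kermx N)); first exact: rank_leq_row.
pose b := row_base (kermx N); pose c j := (row j b)^T.
have /choice[w wc] := fun j => eigenfunction_class l%:C (c j).
exists w; split=> [a a0 j|].
  have := eigenfunction_sum a wc; rewrite a0 => /eigenfunction_inj.
  move=> /(congr1 trmx); rewrite linear_sum trmx0 /= => h.
  have ab : (\row_i a i) *m b = 0.
    rewrite -h mulmx_sum_row; apply: eq_bigr => i _.
    by rewrite linearZ /= trmxK mxE.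
  have /row_freeP[b' bb'] := row_base_free (kermx N).
  have : (\row_i a i) *m b *m b' = 0 by rewrite ab mul0mx.
  by rewrite -mulmxA bb' mulmx1 => /matrixP/(_ 0 j); rewrite !mxE.
apply/seteqP; split=> [u [d /kerP dN ud]|u [a _ <-]] /=.
  have : (d^T <= b)%MS by rewrite eq_row_base.
  move=> /submxP[r rb]; exists (fun j => r 0 j) => //.
  have dE : d = \sum_j r 0 j *: c j.
    apply: trmx_inj; rewrite rb mulmx_sum_row linear_sum; apply: eq_bigr => i _.
    by rewrite linearZ /= trmxK.
  by apply: represents_inj ud; rewrite dE; exact: eigenfunction_sum.
exists (\sum_j a j *: c j); last exact: eigenfunction_sum.
apply/kerP; rewrite linear_sum; apply: summx_sub => j _.
rewrite linearZ /= trmxK scalemx_sub // (submx_trans (row_sub _ _)) //.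
by rewrite eq_row_base.
Qed.

End Solution.

(** * Atomicity of the spectral measure, the spectrum and the eigenspaces *)

Theorem theorem4p2 (R : realType) (n : nat) (alpha beta : 'I_n -> R)
    (n_gt0 : (0 < n)%N)
    (alpha_lt_beta : forall i : 'I_n, alpha i < beta i)
    (beta_lt_alpha : forall i j : 'I_n, (i < j)%N -> beta i < alpha j)
    (A : set (L2_Omega alpha beta * L2_Omega alpha beta))
    (A_sa : self_adjoint (dot_Omega alpha beta) A)
    (A_ext : D_test alpha beta `<=` A)
    (B : 'M[R[i]]_n) (A_B : boundary_matrix A B)
    (P : pvm (dot_Omega alpha beta)) (A_P : spectral_measure A P) :
  let sigma := spectrum (dot_Omega alpha beta) A in
  let sigmaR := [set t : R | sigma t%:C] in
  let Ealpha (l : R[i]) := Emx (fun i => l * (alpha i)%:C) in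
  let Ebeta (l : R[i]) := Emx (fun i => l * (beta i)%:C) in
  [/\ atomic P /\ pvm_null P (~` sigmaR),
      sigma = [set l : R[i] |
        \det (1%:M - invmx (Ebeta l) *m B *m Ealpha l) = 0],
      sigma `<=` [set t%:C | t in [set: R]],
      limit_point sigmaR = set0 /\ ~ bounded_set sigmaR &
      forall l : R, sigmaR l ->
        (exists2 k : nat, (k <= n)%N & has_dimension (range (P [set l])) k) /\
        range (P [set l]) =
          [set u : L2_Omega alpha beta | exists2 c : 'cV[R[i]]_n,
             B *m Ealpha l%:C *m c = Ebeta l%:C *m c &
             represents u (eigenfunction alpha beta l%:C c)]].
Proof.
move=> sigma sigmaR Ealpha Ebeta; have [_ AB] := A_B.
have det0_eigen := det_charmx_eq0 alpha_lt_beta beta_lt_alpha AB.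
have det_res := det_charmx_resolvent alpha_lt_beta beta_lt_alpha A_sa AB.
have sigmaE : sigma = [set l : R[i] |
    \det (1%:M - invmx (Ebeta l) *m B *m Ealpha l) = 0].
  apply/seteqP; split=> l /=; last by move=> /det0_eigen; exact: eigenvalue_spectrum.
  by apply: contra_notP => /eqP; exact: det_res.
have resP (l : R) : ~ eigenvalue_of A l%:C ->
    resolvent_set (dot_Omega alpha beta) A l%:C.
  by move=> nl; apply: det_res; apply/eqP => /det0_eigen.
have gap0 := gap_gt0 alpha beta.
have locdim := eigenprojection_local_dim alpha_lt_beta beta_lt_alpha A_sa AB A_P.
have sRE : sigmaR = [set l : R | eigenvalue_of A l%:C] := spectrum_eigenvalue resP.
split.
- split; first exact: (pvm_atomic A_sa A_P resP gap0 locdim).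
  rewrite sRE; apply: (pvm_null_resolvent A_sa A_P resP); last by rewrite setICl.
  exact: measurableC (measurable_eigenvalues A_sa A_P gap0 locdim).
- exact: sigmaE.
- rewrite sigmaE => l /= /det0_eigen /(eigenvalue_real A_sa) ->.
  by exists (Re l).
- rewrite sRE; split; first exact: (eigenvalues_limit_point A_sa A_P gap0 locdim).
  move=> /(eigenvalues_bounded_domain A_sa A_P resP) dA.
  have [u] := domain_neqT alpha_lt_beta AB n_gt0.
  by apply; exact: dA.
move=> l _.
have rE : range (P [set l]) = [set u : L2_Omega alpha beta |
    exists2 c : 'cV[R[i]]_n, B *m Ealpha l%:C *m c = Ebeta l%:C *m c &
      represents u (eigenfunction alpha beta l%:C c)].
  rewrite (range_eigenproj A_sa A_P); apply/seteqP; split=> u /=.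
    exact: (eigenvector_eigenfunction alpha_lt_beta beta_lt_alpha A_sa AB).
  move=> [c Bc uc].
  have [w wc Aw] := eigenfunction_eigen alpha_lt_beta beta_lt_alpha AB Bc.
  by rewrite (represents_inj uc wc).
by split; [exact: (eigenspace_dim alpha_lt_beta beta_lt_alpha rE) | exact: rE].
Qed.
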